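(* Let $E\subseteq F$ be smooth countable Borel equivalence relations on a standard Borel space $X$, and $E'\subseteq F'$ smooth countable Borel equivalence relations on a standard Borel space $Y$, such that the equivalence relations $[\![\mathrm{lfs}(E,F)]\!]$ on $X/F$ and $[\![\mathrm{lfs}(E',F')]\!]$ on $Y/F'$ both admit Borel parametrizations. Then $(E,F)\cong_B(E',F')$ if and only if $\mathrm{gfs}(E,F)=\mathrm{gfs}(E',F')$.
   Context: Countable Borel equivalence relation: Borel equivalence relation with countable classes; smooth: admits a Borel reduction to equality on some standard Borel space. For smooth countable $F$, the quotient $X/F$ with the $\sigma$-algebra of sets $B$ such that $\bigcup B$ is Borel is a standard Borel space. $(E,F)\cong_B(E',F')$ means there is a Borel bijection $f:X\to Y$ with $x\mathrel{E}y\iff f(x)\mathrel{E'}f(y)$ and $x\mathrel{F}y\iff f(x)\mathrel{F'}f(y)$. For an $F$-class $C$, its local fine shape is $\mathrm{lfs}(C)=\langle n_m:1\leq m\leq\omega\rangle$, where $n_m$ is the number of $E$-classes in $C$ of cardinality exactly $m$ ($m=\omega$ meaning countably infinite). $S_f$ is the set of all functions $\{1,\ldots,\omega\}\to\{0,\ldots,\omega\}$ not identically $0$ (a Polish space with the product of discrete topologies). $\mathrm{lfs}(E,F):X/F\to S_f$ is $C\mapsto\mathrm{lfs}(C)$, and $[\![\mathrm{lfs}(E,F)]\!]$ is the equivalence relation on $X/F$ given by $C\sim C'\iff\mathrm{lfs}(C)=\mathrm{lfs}(C')$. The global fine shape $\mathrm{gfs}(E,F):S_f\to\{0,1,\ldots,\aleph_0,2^{\aleph_0}\}$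 sends $\alpha$ to the number of $F$-classes $C$ with $\mathrm{lfs}(C)=\alpha$. With $\mathbb{C}^+=\{1,2,\ldots,\aleph_0,2^{\aleph_0}\}$, a Borel parametrization of an equivalence relation $D$ on a standard Borel space $Z$ is a Borel bijection $\phi:Z\to\bigsqcup_{\mathfrak m\in\mathbb{C}^+}(Z_{\mathfrak m}\times Y_{\mathfrak m})$ with $Z_{\mathfrak m}$ (possibly empty) standard Borel spaces, $Y_{\mathfrak m}$ standard Borel of cardinality $\mathfrak m$, and $z\mathrel{D}z'\iff\pi_1\phi(z)=\pi_1\phi(z')$. *)

(* Defs.v *)
From HB Require Import structures.
From mathcomp Require Import all_boot all_algebra.
From mathcomp Require Import all_classical all_reals all_analysis.

Set Implicit Arguments.
Unset Strict Implicit.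
Unset Printing Implicit Defensive.

Local Open Scope classical_set_scope.
Local Open Scope card_scope.

(* [measurableType] and [completeType] are pointed, which would exclude empty
   spaces; sigma-algebras are therefore kept as explicit set systems. *)

Definition polish (R : realType) (P : metricType R) : Prop :=
  (exists2 S : set P, countable S & dense S) /\
  (forall u : nat -> P, cauchy (u @ \oo) -> exists l : P, u @ \oo --> l).

Definition standard_borel (R : realType) (T : Type) (M : set_system T) : Prop :=
  exists (P : metricType R) (f : T -> P),
    [/\ polish P, bijective f & M = [set f @^-1` B | B in <<s open >>]].

Record stdBorelType (R : realType) := StdBorelType {
  stdBorel_sort :> Type;
  borel : set_system stdBorel_sort;
  stdBorelP : standard_borel R borel }.

Definition borel_fun (S T : Type) (MS : set_system S) (MT : set_system T)
    (f : S -> T) : Prop :=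
  forall B, MT B -> MS (f @^-1` B).

Definition prod_borel (S T : Type) (MS : set_system S) (MT : set_system T) :
    set_system (S * T) :=
  <<s [set A `*` B | A in MS & B in MT] >>.

Definition sum_borel (I : Type) (T : I -> Type)
    (M : forall i, set_system (T i)) : set_system {i & T i} :=
  [set A | forall i, M i (existT T i @^-1` A)].

Definition countable_borel_equiv (R : realType) (X : stdBorelType R)
    (E : X -> X -> Prop) : Prop :=
  [/\ RelationClasses.Equivalence E,
      prod_borel (@borel R X) (@borel R X) [set p | E p.1 p.2]
    & forall x, countable (E x)].

Definition smooth (R : realType) (X : stdBorelType R)
    (E : X -> X -> Prop) : Prop :=
  exists (Z : stdBorelType R) (f : X -> Z),
    borel_fun (@borel R X) (@borel R Z) f /\
    forall x y, E x y <-> f x = f y.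

Definition quot (X : Type) (F : X -> X -> Prop) : Type :=
  {C : set X | exists x, C = F x}.

Definition quot_borel (X : Type) (M : set_system X) (F : X -> X -> Prop) :
    set_system (quot F) :=
  [set B | M (\bigcup_(C in B) sval C)].

Definition pair_borel_iso (R : realType) (X Y : stdBorelType R)
    (E F : X -> X -> Prop) (E' F' : Y -> Y -> Prop) : Prop :=
  exists f : X -> Y,
    [/\ bijective f, borel_fun (@borel R X) (@borel R Y) f,
        forall x y, E x y <-> E' (f x) (f y)
      & forall x y, F x y <-> F' (f x) (f y)].

Inductive natw : Type := Fin of nat | Omega.
HB.instance Definition _ := gen_eqMixin natw.
HB.instance Definition _ := gen_choiceMixin natw.

Definition posnatw : Type := {m : natw | m != Fin 0}.

Definition has_natw T (A : set T) (m : natw) : Prop :=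
  match m with Fin n => A #= `I_n | Omega => A #= [set: nat] end.

(* The default [Fin 0] is reached only when [A] is uncountable. *)
Definition num_natw T (A : set T) : natw := xget (Fin 0) (has_natw A).

Inductive cardC : Type := Countable of natw | Continuum.
HB.instance Definition _ := gen_eqMixin cardC.
HB.instance Definition _ := gen_choiceMixin cardC.

Definition posC : Type := {c : cardC | c != Countable (Fin 0)}.

Definition has_cardC T (A : set T) (c : cardC) : Prop :=
  match c with Countable m => has_natw A m | Continuum => A #= [set: set nat] end.

(* The default is reached only when [A] is uncountable and not of cardinality
   continuum, which never happens for a Borel subset of a standard Borel
   space. *)
Definition num_cardC T (A : set T) : cardC :=
  xget (Countable (Fin 0)) (has_cardC A).

Definition lfs (X : Type) (E F : X -> X -> Prop) (C : quot F) :
    posnatw -> natw :=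
  fun m => num_natw
    [set D : quot E | sval D `<=` sval C /\ has_natw (sval D) (sval m)].

Definition lfs_rel (X : Type) (E F : X -> X -> Prop) (C C' : quot F) : Prop :=
  lfs E C = lfs E C'.

Definition Sf : Type :=
  {a : posnatw -> natw | exists m, a m != Fin 0}.

Definition gfs (X : Type) (E F : X -> X -> Prop) : Sf -> cardC :=
  fun a => num_cardC [set C : quot F | lfs E C = sval a].

Definition sum_proj1 (I : Type) (Z Y : I -> Type)
    (p : {i : I & (Z i * Y i)%type}) : {i : I & Z i} :=
  existT Z (projT1 p) (projT2 p).1.

Definition borel_parametrizable (R : realType) (Z : Type) (M : set_system Z)
    (D : Z -> Z -> Prop) : Prop :=
  exists (Zp Yp : posC -> stdBorelType R)
         (phi : Z -> {c : posC & (Zp c * Yp c)%type}),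
    [/\ forall c, has_cardC [set: Yp c] (sval c),
        bijective phi,
        borel_fun M
          (sum_borel (fun c => prod_borel (@borel R (Zp c)) (@borel R (Yp c))))
          phi
      & forall z z', D z z' <-> sum_proj1 (phi z) = sum_proj1 (phi z')].

Lemma class_eqP (X : Type) (F : X -> X -> Prop) (C : quot F) (x : X) :
  RelationClasses.Equivalence F -> sval C x -> sval C = F x.
Proof.
case: C => C /= [y ->] [r s t] Fyx; apply/seteqP; split=> z Fz.
  exact: t (s _ _ Fyx) Fz.
exact: t Fyx Fz.
Qed.

Lemma quot_borel_sigma_algebra (X : Type) (M : set_system X)
    (F : X -> X -> Prop) :
  RelationClasses.Equivalence F -> sigma_algebra setT M ->
  sigma_algebra setT (quot_borel M (F := F)).
Proof.
move=> eF [M0 MC MU]; split; rewrite /quot_borel /=.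
- by rewrite bigcup_set0.
- move=> B MB; suff -> : \bigcup_(C in setT `\` B) sval C =
    setT `\` \bigcup_(C in B) sval C by exact: MC.
  apply/seteqP; split=> [x [C [_ nBC] Cx]|x [_ nx]].
    split=> // -[C' BC' C'x]; apply: nBC; suff -> : C = C' by [].
    by apply: eq_sig_hprop => [? ? ?|]; [exact: Prop_irrelevance|]; rewrite (class_eqP eF Cx) (class_eqP eF C'x).
  have Fx : exists y, F x = F y by exists x.
  have Fxx : F x x by case: eF.
  exists (exist _ (F x) Fx) => //; split=> // BFx; apply: nx.
  by exists (exist _ (F x) Fx).
- move=> A MA; suff -> : \bigcup_(C in \bigcup_k A k) sval C =
    \bigcup_k \bigcup_(C in A k) sval C by exact: MU.
  by rewrite bigcup_bigcup.
Qed.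

Lemma countable_has_natw T (A : set T) :
  countable A -> exists m, has_natw A m.
Proof.
move=> cA; have [[n An]|iA] := pselect (finite_set A); first by exists (Fin n).
by exists Omega => /=; rewrite card_eq_le; apply/andP; split=> //; apply/infiniteP.
Qed.

Lemma num_natwP T (A : set T) : countable A -> has_natw A (num_natw A).
Proof. by move=> /countable_has_natw[m Am]; exact: xgetPex (ex_intro _ m Am). Qed.

Lemma lfs_Sf (R : realType) (X : stdBorelType R) (E F : X -> X -> Prop) :
  countable_borel_equiv E -> countable_borel_equiv F ->
  (forall x y, E x y -> F x y) ->
  forall C : quot F, exists m, lfs E C m != Fin 0.
Proof.
move=> [eE _ cE] [eF _ cF] EF C.
have [x Cx] : exists x, sval C x.
  by case: C => C /= [x ->]; exists x; case: eF.
have Exx : E x x by case: eE.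
have [m Em] := countable_has_natw (cE x).
have m0 : m != Fin 0.
  by apply/eqP => m0; move: Em Exx; rewrite m0 /= II0 card_eq0 => /eqP ->.
exists (exist _ m m0); apply/eqP => lfs0.
pose D : quot E := exist _ (E x) (ex_intro _ x erefl).
pose S := [set D : quot E | sval D `<=` sval C /\ has_natw (sval D) m].
change (num_natw S = Fin 0) in lfs0.
have SD : S D.
  by split=> //= y Exy; rewrite (class_eqP eF Cx); exact: EF.
have cS : countable S.
  have cC : countable (sval C) by rewrite (class_eqP eF Cx); exact: cF.
  pose cl y : quot E := exist _ (E y) (ex_intro _ y erefl).
  apply: (@card_le_trans _ _ _ (cl @` sval C)).
    apply: subset_card_le => -[D' [y D'E]] [/= D'C _].
    exists y; first by apply: D'C; rewrite D'E; case: eE.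
    by apply: eq_sig_hprop => [? ? ?|] /=; [exact: Prop_irrelevance|].
  exact: card_le_trans (card_image_le _ _) cC.
have := num_natwP cS; rewrite lfs0 /= II0 card_eq0 => /eqP S0.
by move: SD; rewrite S0.
Qed.

(* Main.v *)
Require Import Defs.
From mathcomp Require Import all_boot all_order all_algebra.
From mathcomp Require Import all_classical all_reals all_analysis.

(**
A bijection preserving [E] and [F] carries classes to classes, so it preserves
the shapes. Conversely, [X] is coded in the Baire space by a Borel injection
whose range depends only on [gfs E F]; two injective Borel codes with the same
range give a Borel bijection, by Lusin's separation theorem.

The code of [x] consists of the local fine shape of its [F]-class, of the
[Y_c]-coordinate of that class in the parametrization (transported to a fixed
set: an initial segment of the integers, or the Cantor set), of the size of the
[E]-class of [x], of the rank of that [E]-class among those of the same size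
inside the [F]-class, and of the rank of [x] inside its [E]-class. Ranks come
from a countable partition of [X] into Borel partial transversals of [F]
(Lusin-Novikov), and they are Borel because injective Borel images of Borel sets
are Borel (Lusin-Souslin).

The Lusin-Novikov dichotomy is proved without ordinals: a finite
approximation of a Cantor set inside one fibre is "good" if it is realised
outside every countable union of Borel partial transversals, and a good
approximation that cannot be split would be realised only inside one more such
transversal.
*)

Set Implicit Arguments.
Unset Strict Implicit.
Unset Printing Implicit Defensive.

Local Open Scope classical_set_scope.
Local Open Scope card_scope.

(** The code leaves out the [Z_c]-coordinate of the parametrization. The classes of one shape [a]
    form a single fibre of the first projection, a copy of [Y_c] over one point of [Z_c]; hence [a]
    determines that point, and [c] is the value of the global fine shape at [a]. So the labels used
    over [a] depend on [gfs E F] alone, and the parametrization is what makes the labelling Borel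
    simultaneously for all shapes.

    The descriptive set theory takes place in the Baire space, with agreement of initial segments in
    place of a topology. A change of topology turns Borel sets into closed ones and lets Borel
    functions be read off coordinates. Separation, injective images and the dichotomy are therefore
    proved for closed sets and maps of the form [a \o e], then transferred. *)

Section sigma_tools.
Context {T : Type} {M : set_system T} (sM : sigma_algebra setT M).

Lemma sigma_not (P : T -> Prop) : M [set x | P x] -> M [set x | ~ P x].
Proof.
case: sM => _ MC _ /MC; congr (M _).
by apply/seteqP; split=> x //= -[].
Qed.

Lemma sigma_ex_nat (P : nat -> T -> Prop) :
  (forall n, M [set x | P n x]) -> M [set x | exists n, P n x].
Proof.
case: sM => _ _ MU /MU; congr (M _).
by apply/seteqP; split=> x /= [n]; [move=> _ ?; exists n | exists n].
Qed.

Lemma sigma_const (P : Prop) : M [set x | P].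
Proof.
case: sM => M0 MC _; have [p|p] := pselect P.
  by move: (MC _ M0); congr (M _); apply/seteqP; split=> x //=; split.
by move: M0; congr (M _); apply/seteqP; split.
Qed.

Lemma sigma_iff (P Q : T -> Prop) :
  (forall x, P x <-> Q x) -> M [set x | P x] -> M [set x | Q x].
Proof. by move=> PQ; congr (M _); apply/seteqP; split=> x /PQ. Qed.

Lemma sigma_ex (I : countType) (P : I -> T -> Prop) :
  (forall i, M [set x | P i x]) -> M [set x | exists i, P i x].
Proof.
move=> MP; have : forall n, M [set x | if unpickle n is Some i then P i x else False].
  by move=> n; case: (unpickle n) => [i|]; [exact: MP|exact: sigma_const].
move/sigma_ex_nat; apply: sigma_iff => x; split=> [[n]|[i Pi]].
  by case: (unpickle n) => [i Pi|//]; exists i.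
by exists (pickle i); rewrite pickleK.
Qed.

Lemma sigma_all (I : countType) (P : I -> T -> Prop) :
  (forall i, M [set x | P i x]) -> M [set x | forall i, P i x].
Proof.
move=> MP; have /sigma_not : M [set x | exists i, ~ P i x].
  by apply: sigma_ex => i; exact: sigma_not.
by apply: sigma_iff => x; split=> [/forallNP H i|H [i]//]; exact: contrapT.
Qed.

Lemma sigma_or (P Q : T -> Prop) :
  M [set x | P x] -> M [set x | Q x] -> M [set x | P x \/ Q x].
Proof.
move=> MP MQ; have : M [set x | exists b : bool, if b then P x else Q x].
  by apply: sigma_ex => -[].
apply: sigma_iff => x; split=> [[[]]|[]]; [by left|by right|by exists true|by exists false].
Qed.

Lemma sigma_and (P Q : T -> Prop) :
  M [set x | P x] -> M [set x | Q x] -> M [set x | P x /\ Q x].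
Proof.
move=> MP MQ; have : M [set x | forall b : bool, if b then P x else Q x].
  by apply: sigma_all => -[].
by apply: sigma_iff => x; split=> [H|[? ?] []//]; split; [exact: (H true)|exact: (H false)].
Qed.

Lemma sigma_imp (P Q : T -> Prop) :
  M [set x | P x] -> M [set x | Q x] -> M [set x | P x -> Q x].
Proof.
move=> MP MQ; have := sigma_or (sigma_not MP) MQ.
by apply: sigma_iff => x; split=> [[]//|H]; have [/H|] := pselect (P x); [right|left].
Qed.

Lemma sigma_equiv (P Q : T -> Prop) :
  M [set x | P x] -> M [set x | Q x] -> M [set x | P x <-> Q x].
Proof. by move=> MP MQ; apply: sigma_and; apply: sigma_imp. Qed.

End sigma_tools.

Lemma generated_preimage S T (M : set_system S) (G : set_system T) (f : S -> T) :
  sigma_algebra setT M -> (forall A, G A -> M [set x | A (f x)]) ->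
  forall A, <<s G >> A -> M [set x | A (f x)].
Proof.
move=> sM GM A; apply: (@smallest_sub _ _ _ [set B | M [set x | B (f x)]]) A => //.
split=> /=.
- exact: (sigma_const sM False).
- move=> A MA; apply: (sigma_iff (P := fun x => ~ A (f x))); first by move=> x; split=> // -[].
  exact: sigma_not.
- move=> A MA; apply: (sigma_iff (P := fun x => exists k, A k (f x))).
    by move=> x; split=> -[k] => [Ak|? Ak]; exists k.
  exact: sigma_ex_nat.
Qed.

Lemma generated_sigma_algebra T (G : set_system T) :
  sigma_algebra setT <<s G >>.
Proof. exact: smallest_sigma_algebra. Qed.

(** * The Baire space *)

Definition baire := nat -> nat.

Definition bor : set_system baire :=
  <<s [set A | exists i j, A = [set a : baire | a i = j]] >>.

Lemma bor_sigma : sigma_algebra setT bor.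
Proof. exact: generated_sigma_algebra. Qed.

Definition bnat T (M : set_system T) (g : T -> nat) :=
  forall j, M [set x | g x = j].

Definition bfun T (M : set_system T) (f : T -> baire) :=
  forall i, bnat M (fun x => f x i).

Lemma bor_cyl i j : bor [set a | a i = j].
Proof. by apply: sub_gen_smallest; exists i, j. Qed.

Section bfun_theory.
Context {T : Type} {M : set_system T} (sM : sigma_algebra setT M).

Lemma bnat_pred (g : T -> nat) (P : nat -> Prop) : bnat M g -> M [set x | P (g x)].
Proof.
move=> mg; apply: (sigma_iff (P := fun x => exists n, g x = n /\ P n)).
  by move=> x; split=> [[n [<-]]//|Px]; exists (g x).
by apply: sigma_ex => // n; apply: sigma_and => //; exact: sigma_const.
Qed.

Lemma bnat_pred2 (g : T -> nat) (P : nat -> T -> Prop) :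
  bnat M g -> (forall n, M [set x | P n x]) -> M [set x | P (g x) x].
Proof.
move=> mg mP; apply: (sigma_iff (P := fun x => exists n, g x = n /\ P n x)).
  by move=> x; split=> [[n [<-]]//|Px]; exists (g x).
by apply: sigma_ex => // n; apply: sigma_and.
Qed.

Lemma bnat_comp2 (g h : T -> nat) (op : nat -> nat -> nat) :
  bnat M g -> bnat M h -> bnat M (fun x => op (g x) (h x)).
Proof.
move=> mg mh j; apply: (@bnat_pred2 g (fun n x => op n (h x) = j)) => // n.
exact: (@bnat_pred h (fun k => op n k = j)).
Qed.

Lemma bnat_comp (g : T -> nat) (op : nat -> nat) :
  bnat M g -> bnat M (fun x => op (g x)).
Proof. by move=> mg j; exact: (@bnat_pred g (fun n => op n = j)). Qed.

Lemma bnat_bool (P : T -> Prop) : M [set x | P x] -> bnat M (fun x => nat_of_bool `[< P x >]).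
Proof.
move=> MP j; apply: (sigma_iff (P := fun x => (P x /\ j = 1) \/ (~ P x /\ j = 0))).
  move=> x; split=> [[[p ->]|[p ->]]|<-]; first by rewrite asboolT.
    by rewrite asboolF.
  by case: asboolP; [left|right].
by apply: sigma_or => //; apply: sigma_and => //; try exact: sigma_const; exact: sigma_not.
Qed.

Lemma bfun_pre (f : T -> baire) B : bfun M f -> bor B -> M [set x | B (f x)].
Proof. by move=> mf; apply: generated_preimage => // A [i [j ->]]; exact: mf. Qed.

Lemma bfun_eq (f g : T -> baire) : bfun M f -> bfun M g -> M [set x | f x = g x].
Proof.
move=> mf mg; apply: (sigma_iff (P := fun x => forall i, f x i = g x i)).
  by move=> x; split=> [/funext//|->].
apply: sigma_all => // i.
apply: (@bnat_pred2 _ (fun n x => n = g x i) (mf i)) => n.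
by apply: (@bnat_pred (fun x => g x i) (fun k => n = k)); exact: mg.
Qed.

Lemma bfun_reindex (f : T -> baire) (e : nat -> nat) :
  bfun M f -> bfun M (fun x => f x \o e).
Proof. by move=> mf i; exact: mf. Qed.

End bfun_theory.

Lemma bfun_id : bfun bor id.
Proof. by move=> i j; exact: bor_cyl. Qed.

Definition pair_nat (i j : nat) : nat := pickle (i, j).
Definition unpair (k : nat) : nat * nat := odflt (0, 0) (unpickle k).

Lemma pair_natK i j : unpair (pair_nat i j) = (i, j).
Proof. by rewrite /unpair /pair_nat pickleK. Qed.

(* [brow h i] is the [i]-th of the countably many points coded by [h]. *)
Definition brow (h : baire) (i : nat) : baire := fun l => h (pair_nat i l).

Definition pack (g : nat -> baire) : baire := fun k => g (unpair k).1 (unpair k).2.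

Lemma packK g i : brow (pack g) i = g i.
Proof. by apply/funext => l; rewrite /brow /pack pair_natK. Qed.

Lemma bfun_brow i : bfun bor (brow ^~ i).
Proof. by move=> l; exact: bfun_id. Qed.

Lemma bfun_pack T (M : set_system T) (g : T -> nat -> baire) :
  (forall i, bfun M (fun x => g x i)) -> bfun M (fun x => pack (g x)).
Proof. by move=> mg k; exact: mg. Qed.

Definition agree n (a b : baire) := forall i, i < n -> a i = b i.

Lemma agree_trans n b a c : agree n a b -> agree n b c -> agree n a c.
Proof. by move=> ab bc i ni; rewrite ab // bc. Qed.

Lemma agree_le m n a b : m <= n -> agree n a b -> agree m a b.
Proof. by move=> mn h i im; apply: h; exact: leq_trans mn. Qed.

Definition bclosed (D : set baire) :=
  forall a, (forall n, exists2 b, D b & agree n a b) -> D a.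

(** The graph of [r] is closed in the product of two Baire spaces. The witness functions below are
    in general not continuous, but this weaker property survives complements and countable
    unions. *)
Definition cgraph (r : baire -> baire) :=
  forall y a, (forall n, exists2 y', agree n y y' & agree n a (r y')) -> a = r y.

Lemma agree_row i n : exists m, forall a b, agree m a b -> agree n (brow a i) (brow b i).
Proof.
elim: n => [|n [m h]]; first by exists 0.
exists (maxn m (pair_nat i n).+1) => a b ab l; rewrite ltnS leq_eqVlt => /orP[/eqP ->|ln].
  by apply: ab; rewrite leq_max ltnS leqnn orbT.
by apply: h ln; apply: agree_le ab; rewrite leq_maxl.
Qed.

Lemma cgraph_pack (r : nat -> baire -> baire) :
  (forall k, cgraph (r k)) -> cgraph (fun y => pack (r ^~ y)).
Proof.
move=> cr y a h; have ar k : brow a k = r k y.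
  apply: cr => n; have [m hm] := agree_row k n.
  have [y' yy' ay'] := h (maxn n m); exists y'.
    by apply: agree_le yy'; rewrite leq_maxl.
  rewrite -(packK (r ^~ y') k); apply: hm; apply: agree_le ay'.
  by rewrite leq_maxr.
apply/funext => k; rewrite /pack -ar /brow; set l := pair_nat _ _.
(* Rows see only the positions that code a pair. A nearby [pack] takes the same value at [k] and at
   the code [l] of [unpair k], hence so does [a]. *)
have [y' _ ay'] := h (maxn k.+1 l.+1).
by rewrite (ay' k) ?(ay' l) ?leq_max ?leqnn ?orbT // /pack /l pair_natK.
Qed.

(* The witness [r y] deciding [B y] is unique: this makes the map [psi] of
   [normal_form] a bijection onto a closed set, hence usable for Lusin-Souslin. *)
Definition witnessed (B : set baire) := exists r : baire -> baire,
  [/\ bfun bor r, cgraph r & forall y, (r y 0 != 0) <-> B y].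

(** The new head depends on one coordinate of the old witness, which is kept as the tail; so it
    passes to limits along the graph even where [r y 0] is discontinuous in [y]. *)
Lemma cgraph_cons (r : baire -> baire) (op : nat -> nat) :
  cgraph r -> cgraph (fun y k => if k is k'.+1 then r y k' else op (r y 0)).
Proof.
move=> cr y a h; have ar : (fun k => a k.+1) = r y.
  apply: cr => n; have [y' yy' ay'] := h n.+1; exists y'.
    exact: agree_le yy'.
  by move=> i ni; rewrite (ay' i.+1).
apply/funext => -[|k]; last by rewrite -ar.
have [y' _ ay'] := h 2; rewrite (ay' 0) // -ar; congr op.
by rewrite (ay' 1).
Qed.

Lemma bfun_cons (r : baire -> baire) (op : nat -> nat) :
  bfun bor r -> bfun bor (fun y k => if k is k'.+1 then r y k' else op (r y 0)).
Proof. by move=> mr [|k]; [exact: (bnat_comp bor_sigma op (mr 0))|exact: mr]. Qed.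

Lemma witnessedC B : witnessed B -> witnessed (setT `\` B).
Proof.
move=> [r [mr cr rB]].
exists (fun y k => if k is k'.+1 then r y k' else nat_of_bool (r y 0 == 0)); split.
- exact: (bfun_cons (fun n => nat_of_bool (n == 0))).
- exact: (@cgraph_cons _ (fun n => nat_of_bool (n == 0))).
- move=> y; split => [|[_ nB]].
    by case: (r y 0 =P 0) => // ry0 _; split=> // /rB; rewrite ry0.
  by case: (r y 0 =P 0) => // /eqP/rB.
Qed.

(** The head is one plus the least [k] with [y] in [B k], or 0 if there is none, and the tail packs
    all the witnesses. A mere bit would not give a closed graph, as the indices could escape to
    infinity along a sequence; a head [k.+1] is certified by finitely many coordinates of the
    tail. *)
Lemma witnessedU (B : nat -> set baire) :
  (forall k, witnessed (B k)) -> witnessed (\bigcup_k B k).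
Proof.
move=> /choice[r hr].
have mr k : bfun bor (r k) by case: (hr k).
have cr k : cgraph (r k) by case: (hr k).
have rB k y : (r k y 0 != 0) <-> B k y by case: (hr k).
pose lst y n := r n y 0 != 0 /\ forall i, i < n -> r i y 0 = 0.
pose w y : nat := xget 0 [set n | exists2 k, n = k.+1 & lst y k].
have lst_uniq y k k' : lst y k -> lst y k' -> k = k'.
  move=> [h1 h2] [h1' h2']; case: (ltngtP k k') => // kk'.
    by rewrite h2' ?eqxx in h1.
  by rewrite h2 ?eqxx in h1'.
have wS y k : w y = k.+1 <-> lst y k.
  split=> [wk|lk].
    by move: wk; rewrite /w; case: xgetP => // n _ [k' -> lk'] [<-].
  rewrite /w; case: xgetP => [n _ [k' -> lk']|/(_ k.+1)[]]; last by exists k.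
  by rewrite (lst_uniq _ _ _ lk lk').
have lst_ex y : (exists k, r k y 0 != 0) -> exists k, lst y k.
  move=> /ex_minnP[k hk hmin]; exists k; split=> // i ik; apply/eqP; apply: contraLR ik.
  by move/hmin; rewrite leqNgt.
have w0 y : w y != 0 <-> exists k, r k y 0 != 0.
  split=> [|/lst_ex[k /wS ->//]].
  by case e : (w y) => [//|k] _; move/wS: e => -[rk _]; exists k.
exists (fun y k => if k is k'.+1 then r (unpair k').1 y (unpair k').2 else w y); split.
- move=> [|k]; last exact: mr.
  move=> [|j] /=.
    apply: (@sigma_iff _ bor (fun y => ~ exists k, r k y 0 != 0)).
      by move=> y; rewrite -w0; split=> [/negP/negPn/eqP//|->].
    apply: (sigma_not bor_sigma); apply: (sigma_ex bor_sigma) => k.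
    exact: (bnat_pred bor_sigma (fun n => n != 0) (mr k 0)).
  apply: (@sigma_iff _ bor (fun y => lst y j)); first by move=> y; rewrite wS.
  apply: (sigma_and bor_sigma).
    exact: (bnat_pred bor_sigma (fun n => n != 0) (mr j 0)).
  apply: (sigma_all bor_sigma) => i; apply: (sigma_imp bor_sigma).
    exact: (sigma_const bor_sigma).
  exact: mr.
- move=> y a h.
  have ar : (fun l => a l.+1) = pack (r ^~ y).
    apply: (cgraph_pack cr) => n; have [y' yy' ay'] := h n.+1; exists y'.
      exact: agree_le yy'.
    by move=> i ni; rewrite (ay' i.+1).
  have ar0 k : a (pair_nat k 0).+1 = r k y 0.
    by rewrite -[LHS]/((fun l => a l.+1) (pair_nat k 0)) ar /pack pair_natK.
  have rnear m : exists y', w y' = a 0 /\ forall k, k < m -> r k y' 0 = r k y 0.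
    have [n hn] : exists n, forall k, k < m -> (pair_nat k 0).+1 < n.
      elim: m => [|m [n hn]]; first by exists 0.
      exists (maxn n (pair_nat m 0).+2) => k; rewrite ltnS leq_eqVlt => /orP[/eqP->|km].
        by rewrite leq_max leqnn orbT.
      by rewrite leq_max hn.
    have [y' _ ay'] := h n.+1; exists y'; split; first by rewrite (ay' 0).
    by move=> k km; rewrite -ar0 (ay' (pair_nat k 0).+1) ?pair_natK // ltnS ltnW // hn.
  apply/funext => -[|k]; last by rewrite -[LHS]/((fun l => a l.+1) k) ar.
  case e : (w y) => [|k].
    case a0 : (a 0) => [//|k]; have [y' [wy' ry']] := rnear k.+1.
    have /wS[rk _] : w y' = k.+1 by rewrite wy'.
    have /w0 : exists i, r i y 0 != 0 by exists k; rewrite -ry'.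
    by rewrite e.
  have [y' [<- ry']] := rnear k.+1; apply/wS; move/wS: e => -[rk rlt]; split.
    by rewrite ry'.
  by move=> i ik; rewrite ry' ?rlt // ltnS ltnW.
- move=> y; rewrite w0; split=> [[k /rB Bk]|[k _ /rB rk]]; by exists k.
Qed.

Lemma bor_witnessed B : bor B -> witnessed B.
Proof.
apply: smallest_sub => [|A [i [j ->]]].
  split=> [|A|A]; [|exact: witnessedC|exact: witnessedU].
  exists (fun _ _ => 0); split=> [k j|y a h|y]; first exact: (sigma_const bor_sigma).
    by apply/funext => k; have [y' _ ->] := h k.+1.
  by split.
exists (fun y _ => nat_of_bool (y i == j)); split=> [k|y a h|y /=].
- exact: (bnat_comp bor_sigma (fun n => nat_of_bool (n == j)) (bfun_id i)).
- apply/funext => k; have [y' yy' ay'] := h (maxn k.+1 i.+1).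
  by rewrite ay' ?yy' ?leq_max ?leqnn ?orbT.
- by case: (y i =P j) => yij; split.

Qed.

(* Refining the topology: a Borel set becomes a closed set, and countably many
   Borel sets become clopen, all at once. *)
Lemma normal_form (B : set baire) (S : nat -> set baire) :
  bor B -> (forall i, bor (S i)) ->
  exists psi : baire -> baire,
    [/\ bfun bor psi, forall y, brow (psi y) 0 = y, bclosed [set psi y | y in B]
      & forall i y, psi y (pair_nat i.+2 0) = nat_of_bool `[< S i y >]].
Proof.
move=> /bor_witnessed[rB [mB cB hB]] bS.
have /choice[r hr] : forall i, exists r : baire -> baire,
    [/\ bfun bor r, cgraph r & forall y, (r y 0 != 0) <-> S i y].
  by move=> i; exact: bor_witnessed.
pose bit (n : nat) := nat_of_bool (n != 0).
(* Row 0 keeps the point and row 1 the witness of [B]. The witness of [S i], in row [i.+2], receives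
   a head normalised to 0 or 1, so that this coordinate is the indicator of [S i]. *)
pose rr i : baire -> baire := match i with 0 => id | 1 => rB | i'.+2 =>
  fun y k => if k is k'.+1 then r i' y k' else bit (r i' y 0) end.
have crr i : cgraph (rr i).
  case: i => [|[|i]] //=.
    by move=> y a h; apply/funext => k; have [y' yy' ay'] := h k.+1; rewrite ay' ?yy'.
  by apply: (@cgraph_cons (r i) bit); case: (hr i).
pose psi y := pack (rr ^~ y).
exists psi; split.
- apply: bfun_pack => -[|[|i]]; [exact: bfun_id|exact: mB|].
  by apply: (bfun_cons bit); case: (hr i).
- by move=> y; rewrite packK.
- move=> a h; have apsi : a = psi (brow a 0).
    apply: (cgraph_pack crr) => n; have [m hm] := agree_row 0 n.
    have [_ [y By <-] ay] := h (maxn n m); exists y.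
      rewrite -[y](packK (rr ^~ y) 0); apply: hm; apply: agree_le ay.
      exact: leq_maxr.
    by apply: agree_le ay; exact: leq_maxl.
  exists (brow a 0) => //; apply/hB.
  have -> : rB (brow a 0) 0 = a (pair_nat 1 0) by rewrite {2}apsi /psi /pack pair_natK.
  have [_ [y By <-] ->] := h (pair_nat 1 0).+1; last exact: ltnSn.
  by rewrite /psi /pack pair_natK; apply/hB.
- move=> i y; rewrite /psi /pack pair_natK /= /bit.
  have [_ _ /(_ y) h] := hr i.
  by congr nat_of_bool; apply/idP/asboolP => /h.
Qed.

Lemma dependent_choice_nat T (P : nat -> T -> Prop) (Q : nat -> T -> T -> Prop) x0 :
  P 0 x0 -> (forall n x, P n x -> exists2 y, P n.+1 y & Q n x y) ->
  exists f : nat -> T, [/\ f 0 = x0, forall n, P n (f n) & forall n, Q n (f n) (f n.+1)].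
Proof.
move=> P0 h; have /choice[g hg] : forall p : nat * T, exists y,
    P p.1 p.2 -> P p.1.+1 y /\ Q p.1 p.2 y.
  move=> [n x]; have [/h[y ? ?]|nP] := pselect (P n x); first by exists y.
  by exists x.
pose fix f n := if n is m.+1 then g (m, f m) else x0.
have Pf n : P n (f n) by elim: n => //= n /(hg (n, _))[].
by exists f; split=> // n; have [] := hg (n, f n) (Pf n).
Qed.

Lemma agree_limit (f : nat -> baire) : (forall n, agree n (f n) (f n.+1)) ->
  forall n, agree n (fun i => f i.+1 i) (f n).
Proof.
move=> h n i; elim: n => // n ih; rewrite ltnS leq_eqVlt => /orP[/eqP -> //|ni].
by rewrite ih // h.
Qed.

Lemma bclosed_bor D : bclosed D -> bor D.
Proof.
move=> cD; apply: (@sigma_iff _ bor (fun a => forall n, exists s : seq nat,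
    (exists2 b, D b & mkseq b n = s) /\ forall i, i < n -> a i = nth 0 s i)).
  move=> a; split=> [h|Da n].
    apply: cD => n; have [s [[b Db bs] as_]] := h n; exists b => // i ni.
    by rewrite as_ // -bs nth_mkseq.
  by exists (mkseq a n); split=> [|i ni]; [exists a|rewrite nth_mkseq].
apply: (sigma_all bor_sigma) => n; apply: (sigma_ex bor_sigma) => s.
apply: (sigma_and bor_sigma); first exact: (sigma_const bor_sigma).
apply: (sigma_all bor_sigma) => i; apply: (sigma_imp bor_sigma).
  exact: (sigma_const bor_sigma).
exact: bor_cyl.
Qed.

Lemma bor_mkseq n s : bor [set a | mkseq a n = s].
Proof.
apply: (@sigma_iff _ bor (fun a => size s = n /\ forall i, i < n -> a i = nth 0 s i)).
  move=> a; split=> [[sn h]|<-].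
    by apply: (@eq_from_nth _ 0); rewrite size_mkseq // => i ni; rewrite nth_mkseq // h.
  by split=> [|i ni]; rewrite ?size_mkseq // nth_mkseq.
apply: (sigma_and bor_sigma); first exact: (sigma_const bor_sigma).
apply: (sigma_all bor_sigma) => i; apply: (sigma_imp bor_sigma).
  exact: (sigma_const bor_sigma).
exact: bor_cyl.
Qed.

(** * Analytic sets *)

(** Projection of a Borel set of pairs, a pair being stored as rows 0 and 1 of one point. *)
Definition analytic (A : set baire) := exists Q : baire -> baire -> Prop,
  bor [set h | Q (brow h 0) (brow h 1)] /\ A = [set b | exists g, Q b g].

(** In normal form the Borel set of pairs is closed and the first member of a pair sits at fixed
    coordinates, so the projection becomes a reindexing. *)
Lemma analytic_closed A : analytic A ->
  exists D e, bclosed D /\ A = [set a \o e | a in D].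
Proof.
move=> [Q [bQ ->]]; have [|psi [_ psi0 cpsi _]] := normal_form (S := fun=> setT) bQ.
  by move=> _; exact: (sigma_const bor_sigma).
exists [set psi y | y in [set h | Q (brow h 0) (brow h 1)]].
exists (fun l => pair_nat 0 (pair_nat 0 l)); split=> //.
apply/seteqP; split=> [b [g Qbg]|_ [_ [h Qh <-] <-]] /=.
  pose h := pack (fun i => if i is 0 then b else g).
  exists (psi h).
    by exists h => //; rewrite /= !packK.
  by apply/funext => l; rewrite -[RHS]/(b l) -[b](packK (fun i => if i is 0 then b else g) 0)
    -/h -[in RHS](psi0 h).
exists (brow h 1); suff -> : psi h \o (fun l => pair_nat 0 (pair_nat 0 l)) = brow h 0 by [].
by rewrite -[in RHS](psi0 h).
Qed.

Definition separated (A B : set baire) :=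
  exists S, [/\ bor S, A `<=` S & forall x, S x -> ~ B x].

Lemma separated_cupl (A : nat -> set baire) B :
  (forall k, separated (A k) B) -> separated (\bigcup_k A k) B.
Proof.
move=> /choice[S hS]; exists [set x | exists k, S k x]; split.
- by apply: (sigma_ex bor_sigma) => k; case: (hS k).
- by move=> x [k _ Ax]; exists k; case: (hS k) => _ AS _; exact: AS.
- by move=> x [k]; case: (hS k) => _ _; exact.
Qed.

Lemma separated_cupr A (B : nat -> set baire) :
  (forall k, separated A (B k)) -> separated A (\bigcup_k B k).
Proof.
move=> /choice[S hS]; exists [set x | forall k, S k x]; split.
- by apply: (sigma_all bor_sigma) => k; case: (hS k).
- by move=> x Ax k; case: (hS k) => _ AS _; exact: AS.
- by move=> x Sx [k _]; case: (hS k) => _ _; exact.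
Qed.

Lemma separated_sub A A' B B' : A `<=` A' -> B `<=` B' ->
  separated A' B' -> separated A B.
Proof.
move=> AA BB [S [bS AS SB]]; exists S; split=> // [x /AA/AS//|x /SB nB /BB].
exact: nB.
Qed.

(** Separation passes to countable unions on either side. From inseparable images one can thus fix
    one more coordinate on each side and keep inseparable pieces; these shrink to points of [D1] and
    [D2], whose images differ at some coordinate, and a cylinder then separates two small pieces. *)
Lemma lusin_separation A B : analytic A -> analytic B ->
  (forall x, A x -> ~ B x) -> separated A B.
Proof.
move=> /analytic_closed[D1 [e1 [c1 ->]]] /analytic_closed[D2 [e2 [c2 ->]]] dis.
pose img (D : set baire) (e : nat -> nat) n a := [set b \o e | b in [set b | D b /\ agree n a b]].
have imgU D e n a : img D e n a `<=`
    \bigcup_k img D e n.+1 (fun i => if i == n then k else a i).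
  move=> _ [b [Db ab] <-]; exists (b n) => //; exists b => //; split=> // i.
  by case: eqP => [->//|/eqP ni]; rewrite ltnS leq_eqVlt (negbTE ni); exact: ab.
apply: contrapT => ns.
have := @dependent_choice_nat (baire * baire)
  (fun n st => ~ separated (img D1 e1 n st.1) (img D2 e2 n st.2))
  (fun n st st' => agree n st.1 st'.1 /\ agree n st.2 st'.2) (fun=> 0, fun=> 0).
case=> [||f [_ nsep fnear]].
- move=> sep; apply: ns; apply: separated_sub sep => _ [b Db <-]; by exists b.
- move=> n [a b] /= nsep.
  have [k nk] : exists k, ~ separated
      (img D1 e1 n.+1 (fun i => if i == n then k else a i)) (img D2 e2 n b).
    apply: contrapT => /forallNP h; apply: nsep.
    apply: separated_sub (imgU _ _ _ _) (@subset_refl _ _) _.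
    by apply: separated_cupl => k; exact: contrapT.
  have [l nl] : exists l, ~ separated
      (img D1 e1 n.+1 (fun i => if i == n then k else a i))
      (img D2 e2 n.+1 (fun i => if i == n then l else b i)).
    apply: contrapT => /forallNP h; apply: nk.
    apply: separated_sub (@subset_refl _ _) (imgU _ _ _ _) _.
    by apply: separated_cupr => l; exact: contrapT.
  exists (fun i => if i == n then k else a i, fun i => if i == n then l else b i) => //=.
  by split=> i ni; rewrite ltn_eqF.
pose a i := (f i.+1).1 i; pose b i := (f i.+1).2 i.
have an n : agree n a (f n).1 by apply: (@agree_limit (fun n => (f n).1)) => m; case: (fnear m).
have bn n : agree n b (f n).2 by apply: (@agree_limit (fun n => (f n).2)) => m; case: (fnear m).
(* An empty piece is separated from everything, so every piece meets the closed set [D1]. *)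
have Da : D1 a.
  apply: c1 => n; apply: contrapT => h; apply: (nsep n); exists set0; split=> //.
    exact: (sigma_const bor_sigma False).
  by move=> _ [c [Dc cn] <-]; case: h; exists c => //; exact: agree_trans (an n) cn.
have Db : D2 b.
  apply: c2 => n; apply: contrapT => h; apply: (nsep n); exists setT; split=> //.
    exact: (sigma_const bor_sigma True).
  move=> x _ [c [Dc cn] _]; case: h; exists c => //; exact: agree_trans (bn n) cn.
have ne : a \o e1 <> b \o e2 by move=> ab; apply: (dis (a \o e1)); [exists a|exists b].
have [i abi] : exists i, a (e1 i) <> b (e2 i).
  by apply: contrapT => /forallNP h; apply: ne; apply/funext => i; exact: contrapT (h i).
(* At this stage the two coordinates that give the [i]-th values of the images are fixed. *)
pose n := (maxn (e1 i) (e2 i)).+1.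
have n1 : e1 i < n by rewrite ltnS leq_maxl.
have n2 : e2 i < n by rewrite ltnS leq_maxr.
apply: (nsep n); exists [set w | w i = a (e1 i)]; split; first exact: bor_cyl.
  by move=> _ [c [_ cn] <-] /=; rewrite -(cn _ n1) -(an n _ n1).
move=> w /= wi [c [_ cn] cw]; apply: abi; rewrite -wi -cw /=.
by rewrite -(cn _ n2) -(bn n _ n2).
Qed.

(** * Injective Borel images *)

(** By injectivity, the images [C s] of the pieces of [D] with distinct initial segments [s] of one
    length are disjoint analytic sets, hence have disjoint Borel hulls [Q s]. Lying in the image
    then amounts to following, at every length, a segment of [D] whose hull contains the point. *)
Lemma image_closed_bor D e : bclosed D ->
  (forall a b, D a -> D b -> a \o e = b \o e -> a = b) ->
  bor [set a \o e | a in D].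
Proof.
move=> cD injD.
pose C (s : seq nat) := [set w | exists g, [/\ D g, mkseq g (size s) = s & w = g \o e]].
have aC s : analytic (C s).
  exists (fun w g => [/\ D g, mkseq g (size s) = s & w = g \o e]); split=> //.
  apply: (@sigma_iff _ bor (fun h => (D (brow h 1) /\ mkseq (brow h 1) (size s) = s)
      /\ brow h 0 = brow h 1 \o e)); first by move=> h; split=> [[[]]|[]].
  apply: (sigma_and bor_sigma); [apply: (sigma_and bor_sigma)|].
  - exact: (bfun_pre bor_sigma (bfun_brow 1) (bclosed_bor cD)).
  - exact: (bfun_pre bor_sigma (bfun_brow 1) (bor_mkseq _ _)).
  - apply: (bfun_eq bor_sigma); first exact: bfun_brow.
    by apply: (@bfun_reindex _ _ (brow ^~ 1)); exact: bfun_brow.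
have /choice[S hS] : forall st : seq nat * seq nat, exists S, bor S /\
    (size st.1 = size st.2 -> st.1 <> st.2 ->
     C st.1 `<=` S /\ forall x, S x -> ~ C st.2 x).
  move=> [s t] /=; have [[szst st]|h] := pselect (size s = size t /\ s <> t); last first.
    exists set0; split; first exact: (sigma_const bor_sigma False).
    by move=> sz st; case: h.
  have [|S [bS ? ?]] := lusin_separation (aC s) (aC t); last by exists S.
  move=> x [g [Dg gs xg]] [g' [Dg' gt xg']]; apply: st.
  by rewrite -gs -gt szst (injD g g') // -xg -xg'.
(* Every separator is used twice, inside for one segment and outside for the other; this makes the
   hulls of equal length disjoint. *)
pose Q s w := forall t, size t = size s -> t <> s -> S (s, t) w /\ ~ S (t, s) w.
have bQ s : bor [set w | Q s w].
  apply: (sigma_all bor_sigma) => t.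
  do 2 (apply: (sigma_imp bor_sigma); first exact: (sigma_const bor_sigma)).
  apply: (sigma_and bor_sigma); first exact: (hS (s, t)).1.
  apply: (sigma_not bor_sigma); exact: (hS (t, s)).1.
have QE s t w : size s = size t -> Q s w -> Q t w -> s = t.
  move=> szst Qs Qt; apply: contrapT => st.
  by have [? _] := Qs t (esym szst) (nesym st); have [] := Qt s szst st.
have CQ s : C s `<=` Q s.
  move=> w Cw t szts ts; have [_ h1] := hS (s, t); have [_ h2] := hS (t, s).
  have [CS _] := h1 (esym szts) (nesym ts); have [_ SC] := h2 szts ts.
  by split; [exact: CS|move=> /SC].
(* Requiring the hulls of all [take m s] makes the segments chosen for different [n] extend each
   other. The last clause forces [w] to be the image of their limit, since the hulls alone need not
   shrink to it. *)
apply: (@sigma_iff _ bor (fun w => forall n, exists s,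
   (size s = n /\ exists2 d, D d & mkseq d n = s) /\ ((forall m, m <= n -> Q (take m s) w) /\
   (forall i, e i < n -> w i = nth 0 s (e i))))); last first.
  apply: (sigma_all bor_sigma) => n; apply: (sigma_ex bor_sigma) => s.
  apply: (sigma_and bor_sigma); first exact: (sigma_const bor_sigma).
  apply: (sigma_and bor_sigma); apply: (sigma_all bor_sigma) => i;
    (apply: (sigma_imp bor_sigma); first exact: (sigma_const bor_sigma)).
    exact: bQ.
  exact: bor_cyl.
move=> w; split=> [/choice[s hs]|[d Dd <-] n]; last first.
  exists (mkseq d n); split; first by rewrite size_mkseq; split=> //; exists d.
  split=> [m mn|i ein]; last by rewrite nth_mkseq.
  have -> : take m (mkseq d n) = mkseq d m by rewrite /mkseq -map_take take_iota (minn_idPl mn).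
  by apply: CQ; exists d; rewrite size_mkseq.
have szs n : size (s n) = n by case: (hs n) => -[].
have tks m n : m <= n -> take m (s n) = s m.
  move=> mn; apply: (QE _ _ w); first by rewrite size_take !szs; case: ltngtP mn.
    by case: (hs n) => _ [+ _]; exact.
  by case: (hs m) => _ [/(_ m (leqnn _)) + _]; rewrite take_oversize // szs.
pose a i := nth 0 (s i.+1) i.
have as_ n : mkseq a n = s n.
  apply: (@eq_from_nth _ 0); rewrite size_mkseq ?szs // => i ni.
  by rewrite nth_mkseq // /a -(tks i.+1 n) // nth_take.
exists a.
  apply: cD => n; have [[_ [d Dd ds]] _] := hs n; exists d => // i ni.
  by move: ds; rewrite -as_ => /(congr1 (nth 0 ^~ i)); rewrite !nth_mkseq.
apply/funext => i /=; have [_ [_ ->]] := hs (e i).+1; last exact: ltnSn.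
by [].
Qed.

(** The graph of [f] on [B] is Borel, hence closed in normal form. The value of [f] is read from it
    by a reindexing, which is injective there because [f] is injective on [B]. *)
Lemma image_bor (f : baire -> baire) B : bfun bor f -> bor B ->
  (forall a b, B a -> B b -> f a = f b -> a = b) -> bor (f @` B).
Proof.
move=> mf bB injB.
pose g a := pack (fun i => if i is 0 then a else f a).
have mg : bfun bor g.
  by apply: bfun_pack => -[|i]; [exact: bfun_id|exact: mf].
pose B' := [set h | B (brow h 0) /\ h = g (brow h 0)].
have bB' : bor B'.
  apply: (sigma_and bor_sigma); first exact: (bfun_pre bor_sigma (bfun_brow 0)).
  apply: (bfun_eq bor_sigma); first exact: bfun_id.
  by move=> i j; apply: (bfun_pre bor_sigma (bfun_brow 0) (mg i j)).
have [|psi [_ psi0 cpsi _]] := normal_form (S := fun=> setT) bB'.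
  by move=> _; exact: (sigma_const bor_sigma).
have -> : f @` B = [set a \o (fun l => pair_nat 0 (pair_nat 1 l)) | a in psi @` B'].
  have E h : psi h \o (fun l => pair_nat 0 (pair_nat 1 l)) = brow h 1.
    by rewrite -[in RHS](psi0 h).
  apply/seteqP; split=> [_ [a Ba <-]|_ [_ [h [Bh hg] <-] <-]].
    exists (psi (g a)); last by rewrite E packK.
    by exists (g a) => //; rewrite /B' /= packK.
  by rewrite E; exists (brow h 0) => //; rewrite [in RHS]hg packK.
apply: image_closed_bor => // _ _ [h [Bh hg] <-] [h' [Bh' hg'] <-].
rewrite -[LHS]/(brow (brow (psi h) 0) 1) -[RHS]/(brow (brow (psi h') 0) 1) !psi0.
rewrite hg hg' !packK => ff; congr (psi (g _)); exact: injB.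
Qed.

Lemma analytic_image (f : baire -> baire) B : bfun bor f -> bor B -> analytic (f @` B).
Proof.
move=> mf bB; exists (fun w a => B a /\ f a = w); split; last first.
  by apply/seteqP; split=> [w [a Ba fa]|w [a [Ba fa]]]; exists a.
apply: (sigma_and bor_sigma); first exact: (bfun_pre bor_sigma (bfun_brow 1)).
apply: (bfun_eq bor_sigma); last exact: bfun_brow.
by move=> i j; apply: (bfun_pre bor_sigma (bfun_brow 1) (mf i j)).
Qed.

(** * The Lusin-Novikov dichotomy *)

Section lusin_novikov.
Variables (D : set baire) (e : nat -> nat).
Hypothesis cD : bclosed D.

(** Partial transversal of the relation [a \o e = b \o e]. *)
Definition einj (A : set baire) :=
  forall a b, A a -> A b -> a \o e = b \o e -> a = b.

Lemma bor_same (f g : baire -> baire) : bfun bor f -> bfun bor g ->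
  bor [set h | f h \o e = g h \o e].
Proof. by move=> bf bg; apply: (bfun_eq bor_sigma); exact: bfun_reindex. Qed.

Lemma analytic_neighbours A : analytic A -> analytic [set b | exists a,
  A a /\ [/\ D b, a <> b & a \o e = b \o e]].
Proof.
move=> [Q [bQ ->]].
exists (fun b g => Q (brow g 0) (brow g 1) /\
  [/\ D b, brow g 0 <> b & brow g 0 \o e = b \o e]); split; last first.
  apply/seteqP; split=> [b [a [[g Qag] h]]|b [g [Qg h]]] /=.
    by exists (pack (fun i => if i is 0 then a else g)); rewrite !packK.
  by exists (brow g 0); split=> //; exists (brow g 1).
have b1 i : bfun bor (fun h => brow (brow h 1) i) by move=> l; exact: bfun_id.
apply: (sigma_and bor_sigma); first exact: (bfun_pre bor_sigma (bfun_brow 1) bQ).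
apply: (@sigma_iff _ bor (fun h => (D (brow h 0) /\ ~ brow (brow h 1) 0 = brow h 0) /\
  brow (brow h 1) 0 \o e = brow h 0 \o e)); first by move=> h; split=> [[[]]|[]].
apply: (sigma_and bor_sigma); first apply: (sigma_and bor_sigma).
- exact: (bfun_pre bor_sigma (bfun_brow 0) (bclosed_bor cD)).
- by apply: (sigma_not bor_sigma); apply: (bfun_eq bor_sigma) => //; exact: bfun_brow.
- by apply: bor_same => //; exact: bfun_brow.
Qed.

Lemma analytic_bor A : bor A -> analytic A.
Proof.
move=> bA; exists (fun b _ => A b); split; first exact: (bfun_pre bor_sigma (bfun_brow 0)).
by apply/seteqP; split=> [b Ab|b [_]//]; exists b.
Qed.

(* Two successive separations: the first makes the hull disjoint from the
   neighbours of [A], the second from the neighbours of the first hull. *)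
Lemma einj_hull A : analytic A -> A `<=` D -> einj A ->
  exists B, [/\ bor B, A `<=` B & einj (D `&` B)].
Proof.
move=> aA AD injA.
have [|S1 [bS1 AS1 S1N]] := lusin_separation aA (analytic_neighbours aA).
  by move=> b Ab [a [Aa [_ ab eab]]]; apply: ab; exact: injA.
have bS1D : bor [set x | S1 x /\ D x].
  by apply: (sigma_and bor_sigma) => //; exact: bclosed_bor.
have [|S2 [bS2 AS2 S2N]] := lusin_separation aA (analytic_neighbours (analytic_bor bS1D)).
  move=> b Ab [a [[S1a Da] [Db ab eab]]]; apply: (S1N a S1a).
  by exists b; split=> //; split=> //; exact: nesym.
exists [set x | S1 x /\ S2 x]; split.
- exact: (sigma_and bor_sigma).
- by move=> x Ax; split; [exact: AS1|exact: AS2].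
- move=> a b [Da [S1a S2a]] [Db [S1b S2b]] eab; apply: contrapT => ab.
  by apply: (S2N b S2b); exists a.
Qed.

Definition small (B : nat -> set baire) :=
  forall n, bor (B n) /\ einj (D `&` B n).

Definition starts (s : seq nat) (a : baire) := forall i, i < size s -> a i = nth 0 s i.

Definition config (p : seq (seq nat)) (g : nat -> baire) := forall i, i < size p ->
  [/\ D (g i), starts (nth [::] p i) (g i) & g i \o e = g 0 \o e].

Definition avoids (p : seq (seq nat)) (B : nat -> set baire) (g : nat -> baire) :=
  forall i, i < size p -> forall n, ~ B n (g i).

Definition good (p : seq (seq nat)) :=
  forall B, small B -> exists2 g, config p g & avoids p B g.

Definition differ (s t : seq nat) := exists i,
  [/\ i < size s, i < size t & nth 0 s i <> nth 0 t i].

Definition extends L (s t : seq nat) := prefix s t /\ L <= size t.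

Definition splits L j (p q : seq (seq nat)) :=
  [/\ size q = (size p).+1,
      forall i, i < size p -> extends L (nth [::] p i) (nth [::] q i),
      extends L (nth [::] p j) (nth [::] q (size p))
    & differ (nth [::] q j) (nth [::] q (size p))].

Lemma bor_config p : bor [set h | config p (brow h)].
Proof.
apply: (sigma_all bor_sigma) => i; apply: (sigma_imp bor_sigma).
  exact: (sigma_const bor_sigma).
apply: (@sigma_iff _ bor (fun h => (D (brow h i) /\ starts (nth [::] p i) (brow h i)) /\
  brow h i \o e = brow h 0 \o e)); first by move=> h; split=> [[[]]|[]].
apply: (sigma_and bor_sigma); first apply: (sigma_and bor_sigma).
- exact: (bfun_pre bor_sigma (bfun_brow i) (bclosed_bor cD)).
- apply: (sigma_all bor_sigma) => l; apply: (sigma_imp bor_sigma).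
    exact: (sigma_const bor_sigma).
  exact: bfun_brow.
- by apply: bor_same; exact: bfun_brow.
Qed.

Lemma bor_avoids p B : small B -> bor [set h | avoids p B (brow h)].
Proof.
move=> sB; apply: (sigma_all bor_sigma) => i; apply: (sigma_imp bor_sigma).
  exact: (sigma_const bor_sigma).
apply: (sigma_all bor_sigma) => n; apply: (sigma_not bor_sigma).
exact: (bfun_pre bor_sigma (bfun_brow i) (sB n).1).
Qed.

Lemma prefix_mkseq s (a : baire) M : starts s a -> size s <= M -> prefix s (mkseq a M).
Proof.
move=> sa sM; rewrite prefixE; apply/eqP.
have szt : size (take (size s) (mkseq a M)) = size s by rewrite size_takel ?size_mkseq.
apply: (@eq_from_nth _ 0) => // i; rewrite szt => is_.
by rewrite nth_take // nth_mkseq ?sa // (leq_trans is_).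
Qed.

(** Suppose that no splitting is good. There are countably many candidates [q], so the families that
    defeat them merge into one family [B]. Two distinct equivalent points, each the [j]-th point of
    a realisation of [p] avoiding [B], would together realise some [q] outside its own family. Such
    [j]-th points thus form an analytic partial transversal, and a Borel hull of it, added to [B],
    contradicts the goodness of [p]. *)
Lemma good_split p j L : good p -> j < size p ->
  exists2 q, good q & splits L j p q.
Proof.
move=> gp jp; apply: contrapT => nq.
have /choice[BB hBB] : forall q : seq (seq nat), exists B, small B /\
    (splits L j p q -> forall g, config q g -> avoids q B g -> False).
  move=> q; have [sq|nsq] := pselect (splits L j p q); last first.
    exists (fun=> set0); split=> // n; split; first exact: (sigma_const bor_sigma False).
    by move=> a b [].
  have : ~ good q by move=> gq; apply: nq; exists q.
  move=> /existsNP[B /not_implyP[sB nB]]; exists B; split=> // _ g cg ag.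
  by apply: nB; exists g.
pose B n := if unpickle n is Some (q, m) then BB q m else set0.
have sB : small B.
  move=> n; rewrite /B; case: unpickle => [[q m]|]; first exact: (hBB q).1.
  by split; [exact: (sigma_const bor_sigma False)|move=> a b []].
pose A := [set w | exists h, (config p (brow h) /\ avoids p B (brow h)) /\ w = brow h j].
have aA : analytic A.
  exists (fun w h => (config p (brow h) /\ avoids p B (brow h)) /\ w = brow h j); split=> //.
  apply: (sigma_and bor_sigma).
    apply: (bfun_pre bor_sigma (B := [set h | config p (brow h) /\ avoids p B (brow h)])
      (bfun_brow 1)).
    by apply: (sigma_and bor_sigma); [exact: bor_config|exact: bor_avoids].
  by apply: (bfun_eq bor_sigma); [exact: bfun_brow|move=> l; exact: bfun_id].
have AD : A `<=` D by move=> _ [h [[cg _] ->]]; case: (cg j jp).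
have injA : einj A.
  move=> _ _ [h [[ch ah] ->]] [h' [[ch' ah'] ->]] ehh'; apply: contrapT => neq.
  have [l hl] : exists l, brow h j l <> brow h' j l.
    apply: contrapT => /forallNP H; apply: neq; apply/funext => l.
    exact: contrapT (H l).
  pose g i := if i == size p then brow h' j else brow h i.
  (* Cutting at [M] reaches the length [L], covers all stems of [p], and shows the position [l]
     where the two points differ. *)
  pose M := maxn (maxn L l.+1) (\max_(s <- p) size s).
  have LM : L <= M by rewrite /M !leq_max leqnn.
  have lM : l < M by rewrite /M !leq_max leqnn orbT.
  have pM i : i < size p -> size (nth [::] p i) <= M.
    move=> ip; rewrite /M leq_max; apply/orP; right.
    by rewrite (big_nth [::]) big_mkord (bigD1 (Ordinal ip)) //= leq_maxl.
  pose q := mkseq (fun i => mkseq (g i) M) (size p).+1.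
  have qi i : i <= size p -> nth [::] q i = mkseq (g i) M by move=> ?; rewrite nth_mkseq.
  have gi i : i < size p -> g i = brow h i by move=> ip; rewrite /g ltn_eqF.
  have gp_ : g (size p) = brow h' j by rewrite /g eqxx.
  have [_ /(_ _ g)] := hBB q; apply.
  - split; first by rewrite size_mkseq.
    + move=> i ip; rewrite qi ?(ltnW ip) // gi //; split; last by rewrite size_mkseq.
      by have [_ ? _] := ch i ip; apply: prefix_mkseq => //; exact: pM.
    + rewrite qi // gp_; split; last by rewrite size_mkseq.
      by have [_ ? _] := ch' j jp; apply: prefix_mkseq => //; exact: pM.
    + exists l; rewrite !qi ?(ltnW jp) // !size_mkseq; split=> //.
      by rewrite !nth_mkseq // gi // gp_.
  - have g0 : g 0 \o e = brow h j \o e.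
      by rewrite gi ?(leq_ltn_trans _ jp) //; case: (ch j jp).
    move=> i; rewrite size_mkseq ltnS => ip; rewrite qi // g0.
    have sg : starts (mkseq (g i) M) (g i).
      by move=> k; rewrite size_mkseq => kM; rewrite nth_mkseq.
    move: ip; rewrite leq_eqVlt => /orP[/eqP ii|ip].
      split=> //; rewrite ii gp_; last exact: esym.
      by case: (ch' j jp).
    split=> //; rewrite gi //; first by case: (ch i ip).
    by case: (ch i ip) => _ _ ->; case: (ch j jp).
  - move=> i; rewrite size_mkseq ltnS => ip n.
    have BBn a : BB q n a -> B (pickle (q, n)) a by rewrite /B pickleK.
    move: ip; rewrite leq_eqVlt => /orP[/eqP ->|ip] /BBn.
      by rewrite gp_; exact: ah'.
    by rewrite gi //; exact: ah.
have [H [bH AH injH]] := einj_hull aA AD injA.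
have [|g cg ag] := gp (fun n => if n is m.+1 then B m else H).
  by case=> [|n] //; exact: sB.
apply: (ag j jp 0); apply: AH; exists (pack g); rewrite packK; split=> //.
by split=> i ip; rewrite ?packK; [exact: cg|move=> n; exact: (ag i ip n.+1)].
Qed.

Lemma prefix_nth (s t : seq nat) i : prefix s t -> i < size s -> nth 0 t i = nth 0 s i.
Proof. by move=> /prefixP[u ->] is_; rewrite nth_cat is_. Qed.

Lemma prefix_size (s t : seq nat) : prefix s t -> size s <= size t.
Proof. by move=> /prefixP[u ->]; rewrite size_cat leq_addr. Qed.

Lemma extends_trans L L' s t u : extends L s t -> extends L' t u -> extends L s u.
Proof.
move=> [st Lt] [tu _]; split; first exact: prefix_trans tu.
exact: leq_trans Lt (prefix_size tu).
Qed.

Lemma differ_prefix s s' t t' : prefix s s' -> prefix t t' -> differ s t -> differ s' t'.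
Proof.
move=> ss tt [i [is_ it ne]]; exists i; split.
- exact: leq_trans (prefix_size ss).
- exact: leq_trans (prefix_size tt).
- by rewrite (prefix_nth ss) // (prefix_nth tt).
Qed.

Definition doubles L (p q : seq (seq nat)) :=
  [/\ size q = size p + size p,
      forall i, i < size p -> extends L (nth [::] p i) (nth [::] q i),
      forall i, i < size p -> extends L (nth [::] p i) (nth [::] q (size p + i))
    & forall i, i < size p -> differ (nth [::] q i) (nth [::] q (size p + i))].

(** Stems are split one after the other. Each split appends its new stem at the end, so the second
    half of [q] lists the copies in the order of [p]; this is what [leaf] relies on. *)
Lemma good_double p L : good p -> exists2 q, good q & doubles L p q.
Proof.
move=> gp; have : forall m, m <= size p -> exists2 q, good q & [/\ size q = size p + m,
    forall i, i < size p -> prefix (nth [::] p i) (nth [::] q i) /\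
                            (0 < m -> L <= size (nth [::] q i)),
    forall i, i < m -> extends L (nth [::] p i) (nth [::] q (size p + i))
  & forall i, i < m -> differ (nth [::] q i) (nth [::] q (size p + i))].
  elim=> [_|m ih mp].
    by exists p => //; rewrite addn0; split=> // i _; rewrite prefix_refl.
  have [q gq [szq q1 q2 q3]] := ih (ltnW mp).
  have [|q' gq' [szq' x1 x2 x3]] := good_split (j := m) L gq.
    by rewrite szq ltn_addr.
  have mq : m < size q by rewrite szq ltn_addr.
  exists q' => //; split; first by rewrite szq' szq addnS.
  - move=> i ip; have iq : i < size q by rewrite szq ltn_addr.
    have [xp xs] := x1 i iq; have [pq _] := q1 i ip; split=> //.
    exact: prefix_trans xp.
  - move=> i; rewrite ltnS leq_eqVlt => /orP[/eqP ->|im].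
      rewrite -szq; have [y1 y2] := x2; split=> //; apply: prefix_trans y1.
      by have [] := q1 m mp.
    by apply: extends_trans (q2 i im) (x1 _ _); rewrite szq ltn_add2l.
  - move=> i; rewrite ltnS leq_eqVlt => /orP[/eqP ->|im].
      by rewrite -szq.
    apply: differ_prefix (q3 i im).
      by have [|] := x1 i _; rewrite ?szq ?ltn_addr // (ltn_trans im).
    by have [|] := x1 (size p + i) _; rewrite ?szq ?ltn_add2l.
move=> /(_ _ (leqnn _))[q gq [szq q1 q2 q3]]; exists q => //; split=> // i ip.
have [? h] := q1 i ip; split=> //; apply: h; exact: leq_ltn_trans ip.
Qed.

(** The first [n] bits [b m != 0] read in binary, lowest digit first: the position at stage [n] of
    the stem chosen by [b], since doubling puts the copy of stem [i] at [2 ^ n + i]. *)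
Fixpoint leaf (b : baire) (n : nat) : nat :=
  if n is m.+1 then leaf b m + (b m != 0) * 2 ^ m else 0.

Lemma leaf_lt b n : leaf b n < 2 ^ n.
Proof.
elim: n => //= n ih; rewrite expnS mul2n -addnn; case: (b n != 0).
  by rewrite mul1n ltn_add2r.
by rewrite mul0n addn0 ltn_addr.
Qed.

Lemma bnat_leaf n : bnat bor (leaf ^~ n).
Proof.
elim: n => [|n ih]; first by move=> j /=; exact: (sigma_const bor_sigma).
exact: (bnat_comp2 bor_sigma (fun l k => l + (k != 0) * 2 ^ n) ih (bfun_id n)).
Qed.

(** Without a countable cover, the single empty stem is good, and repeated doubling gives a binary
    tree of stems. The Cantor set is represented by the whole Baire space, where a point counts only
    through its bits [b n != 0]; hence the form of the injectivity clause. *)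
Theorem lusin_novikov_dichotomy :
  (exists B, small B /\ forall a, D a -> exists n, B n a) \/
  (exists h : baire -> baire, [/\ bfun bor h, forall b, D (h b),
     forall b b', h b \o e = h b' \o e
   & forall b b', h b = h b' -> forall n, (b n != 0) = (b' n != 0)]).
Proof.
have [|ncov] := pselect (exists B, small B /\ forall a, D a -> exists n, B n a); first by left.
right; have g0 : good [:: [::]].
  move=> B sB; apply: contrapT => ng; apply: ncov; exists B; split=> // a Da.
  apply: contrapT => /forallNP na; apply: ng; exists (fun=> a).
    by case.  
  by move=> i _ n; exact: na.
have [||P [P0 gP dP]] := @dependent_choice_nat _ (fun n p => good p /\ size p = 2 ^ n)
  (fun n => doubles n.+1) [:: [::]].
- by [].
- move=> n p [gp szp]; have [q gq dq] := good_double n.+1 gp; exists q => //; split=> //.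
  by case: dq => -> _ _ _; rewrite szp addnn -mul2n expnS.
have szP n : size (P n) = 2 ^ n by case: (gP n).
pose st b n := nth [::] (P n) (leaf b n).
have stS b n : extends n.+1 (st b n) (st b n.+1).
  have [_ d1 d2 _] := dP n; rewrite /st /=; case: (b n != 0).
    by rewrite mul1n addnC -(szP n); apply: d2; rewrite szP leaf_lt.
  by rewrite mul0n addn0; apply: d1; rewrite szP leaf_lt.
have st_size b n : n <= size (st b n).
  by case: n => // n; case: (stS b n).
have st_prefix b m n : m <= n -> prefix (st b m) (st b n).
  move=> /subnKC <-; elim: (n - m) => [|k ih]; first by rewrite addn0 prefix_refl.
  by rewrite addnS; apply: prefix_trans ih _; case: (stS b (m + k)).
(* Stems of stage [n] have length at least [n], so stage [i.+1] already fixes coordinate [i]. *)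
pose h b i := nth 0 (st b i.+1) i.
have hst b n : starts (st b n) (h b).
  move=> i is_; rewrite /h; have [ni|/ltnW ni] := leqP n i.+1.
    exact: prefix_nth (st_prefix _ _ _ ni) is_.
  by rewrite (prefix_nth (st_prefix b _ _ ni)).
have cfg n : exists g, config (P n) g.
  have [|g cg _] := (gP n).1 (fun=> set0); last by exists g.
  by move=> k; split; [exact: (sigma_const bor_sigma False)|move=> a b []].
(* Realisations of different stages are unrelated, but one of stage [n] agrees with all branches up
   to [n]. This suffices for the branches to lie in the closed set [D] and in one common fibre. *)
have hagree b n g : config (P n) g -> agree n (h b) (g (leaf b n)).
  move=> cg i ni; have [|_ sg _] := cg (leaf b n); first by rewrite szP leaf_lt.
  have is_ : i < size (st b n) by exact: leq_trans (st_size b n).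
  by rewrite (hst b n) // sg.
exists h; split.
- by move=> i; exact: (bnat_comp bor_sigma (fun l => nth 0 (nth [::] (P i.+1) l) i)
    (bnat_leaf i.+1)).
- move=> b; apply: cD => n; have [g cg] := cfg n; exists (g (leaf b n)).
    by have [|] := cg (leaf b n); rewrite // szP leaf_lt.
  exact: hagree.
- move=> b b'; apply/funext => i /=; have [g cg] := cfg (e i).+1.
  rewrite !(hagree _ _ _ cg) //.
  have [|_ _ E] := cg (leaf b (e i).+1); first by rewrite szP leaf_lt.
  have [|_ _ E'] := cg (leaf b' (e i).+1); first by rewrite szP leaf_lt.
  by rewrite -[LHS]/((g _ \o e) i) -[RHS]/((g _ \o e) i) E E'.
(* At the first bit that differs, the two branches enter the two incompatible copies of one stem. *)
- have key b b' n : leaf b n = leaf b' n -> b n != 0 -> b' n = 0 -> h b <> h b'.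
    move=> lE bn b'n hE; have [_ _ _ d] := dP n.
    have [|i [i1 i2]] := d (leaf b n); first by rewrite szP leaf_lt.
    have e1 : nth [::] (P n.+1) (leaf b n) = st b' n.+1.
      by rewrite /st /= b'n eqxx mul0n addn0 lE.
    have e2 : nth [::] (P n.+1) (size (P n) + leaf b n) = st b n.+1.
      by rewrite /st /= bn mul1n szP addnC.
    rewrite e1 in i1 *; rewrite e2 in i2 *.
    by rewrite -(hst b' n.+1) // -(hst b n.+1) // hE.
  move=> b b' hE; elim/ltn_ind => n ih.
  have lE : leaf b n = leaf b' n.
    elim: n ih => //= n ihn ih; rewrite ih // ihn // => m mn.
    by rewrite ih // ltnW.
  have [b0|bn] := eqVneq (b n) 0; have [b'0|b'n] := eqVneq (b' n) 0 => //.
    by case: (key b' b n).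
  by case: (key b b' n).
Qed.

End lusin_novikov.

(** * Standard Borel spaces as Borel subsets of the Baire space *)

Section polish_code.
Import Order.TTheory GRing.Theory Num.Theory.
Local Open Scope ring_scope.
Variables (R : realType) (P : metricType R).

Let r (n : nat) : R := n.+1%:R^-1.

Let r_gt0 n : 0 < r n. Proof. by rewrite invr_gt0. Qed.

Let r_small (eps : R) : 0 < eps -> exists N, forall n, (N <= n)%N -> r n < eps.
Proof.
move=> e0; have [N _ h] := near_infty_natSinv_lt (PosNum e0).
by exists N => n Nn; exact: h.
Qed.

Lemma countable_dense_seq (S : set P) (x0 : P) : countable S -> dense S ->
  exists d : nat -> P, forall x eps, 0 < eps -> exists n, mdist x (d n) < eps.
Proof.
move=> /countable_injP[f injf] dS.
exists (fun n => xget x0 [set x | S x /\ f x = n]) => x eps e0.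
have [||y [xy Sy]] := dS (ball x eps)°.
- by exists x; apply: nbhsx_ballx.
- exact: open_interior.
exists (f y); rewrite (_ : xget _ _ = y).
  by move/interior_subset: xy; rewrite ballEmdist.
case: xgetP => [z _ [Sz fz]|/(_ y)[]//].
by apply: injf; rewrite ?inE.
Qed.

Lemma open_mdist_ball (x : P) eps : open [set y | mdist y x < eps].
Proof.
rewrite openE => y /= yx; apply/nbhs_ballP; exists (eps - mdist y x) => /=.
  by rewrite subr_gt0.
move=> z; rewrite ballEmdist /= => yz; rewrite /= (le_lt_trans (metric_triangle _ y _)) //.
by rewrite (metric_sym z) -ltrBrDr.
Qed.

Section dense_code.
Variable d : nat -> P.
Hypothesis dP : forall x eps, 0 < eps -> exists n, mdist x (d n) < eps.
Hypothesis complete : forall u : nat -> P, cauchy (u @ \oo) -> exists l : P, u @ \oo --> l.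

(** Records which of the balls of centre [d i] and radius [r n] contain [x]. *)
Let code (x : P) : baire := fun k =>
  nat_of_bool (mdist x (d (unpair k).1) < r (unpair k).2).

Let codeE x i n : (code x (pair_nat i n) != 0%N) = (mdist x (d i) < r n).
Proof. by rewrite /code pair_natK; case: (_ < _). Qed.

(* A point of the Baire space is the code of a limit of the dense sequence iff
   it satisfies the following countably many conditions. *)
Let is_code (y : baire) :=
  ((forall n, exists i, y (pair_nat i n) != 0%N) /\
   (forall i n j m, y (pair_nat i n) != 0%N -> y (pair_nat j m) != 0%N ->
      mdist (d i) (d j) < r n + r m)) /\
  ((forall i n, y (pair_nat i n) != 0%N <->
      exists j m, y (pair_nat j m) != 0%N /\ mdist (d i) (d j) + r m < r n) /\
   (forall k, y k = nat_of_bool (y (pair_nat (unpair k).1 (unpair k).2) != 0%N))).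

Let bor_is_code : bor [set y | is_code y].
Proof.
have bn k : bor [set y | y k != 0%N] by exact: (bnat_pred bor_sigma (fun n => n != 0%N) (bfun_id k)).
apply: (sigma_and bor_sigma); apply: (sigma_and bor_sigma).
- by apply: (sigma_all bor_sigma) => n; apply: (sigma_ex bor_sigma).
- apply: (sigma_all bor_sigma) => i; apply: (sigma_all bor_sigma) => n.
  apply: (sigma_all bor_sigma) => j; apply: (sigma_all bor_sigma) => m.
  by do 2 apply: (sigma_imp bor_sigma) => //; exact: (sigma_const bor_sigma).
- apply: (sigma_all bor_sigma) => i; apply: (sigma_all bor_sigma) => n.
  apply: (sigma_equiv bor_sigma) => //.
  apply: (sigma_ex bor_sigma) => j; apply: (sigma_ex bor_sigma) => m.
  by apply: (sigma_and bor_sigma) => //; exact: (sigma_const bor_sigma).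
- apply: (sigma_all bor_sigma) => k; set l := pair_nat _ _.
  apply: (bnat_pred2 bor_sigma (P := fun n y => n = nat_of_bool (y l != 0%N)) (bfun_id k)) => n.
  exact: (bnat_pred bor_sigma (fun m => n = nat_of_bool (m != 0%N)) (bfun_id l)).
Qed.

Let code_is_code x : is_code (code x).
Proof.
split; split.
- by move=> n; have [i xi] := dP x (r_gt0 n); exists i; rewrite codeE.
- move=> i n j m; rewrite !codeE => xi xj.
  by rewrite (le_lt_trans (metric_triangle _ x _)) // (metric_sym (d i)) ltrD.
- move=> i n; rewrite codeE; split=> [xi|[j [m []]]].
    have dl : 0 < (r n - mdist x (d i)) / 2 by rewrite divr_gt0 // subr_gt0.
    have [m /(_ _ (leqnn m)) rm] := r_small dl.
    have [j xj] := dP x (r_gt0 m); exists j, m; rewrite codeE; split=> //.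
    rewrite (le_lt_trans (y := mdist x (d i) + r m + r m)) //.
      rewrite lerD2r (le_trans (metric_triangle _ x _)) // (metric_sym (d i)) lerD2l.
      exact: ltW.
    by rewrite -addrA -ltrBrDl (lt_le_trans (ltrD rm rm)) // -splitr.
  rewrite codeE => xj; apply: lt_trans; rewrite (le_lt_trans (metric_triangle _ (d j) _)) //.
  by rewrite addrC (metric_sym (d j)) ltrD2l.
- by move=> k; rewrite codeE /code.
Qed.

(** Choosing one ball of each radius [r n] gives centres that form a Cauchy sequence, because the
    recorded balls are pairwise close; the limit is the coded point. *)
Let code_surj y : is_code y -> exists x, code x = y.
Proof.
move=> [[/choice[i iP] yb] [yc ye]].
pose u n := d (i n).
have [l ul] : exists l : P, u @ \oo --> l.
  apply: complete; apply/cauchy_ballP => e e0.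
  have e20 : 0 < e / 2 by rewrite divr_gt0.
  have [N rN] := r_small e20.
  exists ([set u n | n in [set n | (N <= n)%N]], [set u n | n in [set n | (N <= n)%N]]).
    by split; exists N => // n Nn; exists n.
  move=> [_ _] /= [[n /= Nn <-] [m /= Nm <-]]; rewrite ballEmdist /=.
  by rewrite (lt_trans (yb _ _ _ _ (iP n) (iP m))) // [e]splitr ltrD // rN.
(* Only a weak inequality survives the limit. The strict one comes from [yc], which supplies a
   recorded ball well inside the given one. *)
have lle j m : y (pair_nat j m) != 0%N -> mdist l (d j) <= r m.
  move=> yjm; apply/ler_addgt0Pr => eps e0.
  have e20 : 0 < eps / 2 by rewrite divr_gt0.
  have [N rN] := r_small e20.
  have [N' _ lN'] : \forall n \near \oo, mdist l (u n) < eps / 2 by exact: metricType_numDomainType.cvgr_dist_lt.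
  pose k := maxn N N'.
  have h1 := lN' k (leq_maxr _ _); have h2 := rN k (leq_maxl _ _).
  rewrite (le_trans (metric_triangle _ (u k) _)) //.
  have h3 := yb _ _ _ _ (iP k) yjm.
  rewrite ltW // (lt_trans (ltrD h1 h3)) //.
  by rewrite [in ltRHS](splitr eps) addrCA [in ltLHS]addrA addrC ltrD2l // addrC ltrD2l.
exists l; apply/funext => k; rewrite ye /code; set j := (unpair k).1; set n := (unpair k).2.
congr nat_of_bool; apply/idP/idP => [lj|/yc[j' [m [yj' lt]]]].
  have dl : 0 < (r n - mdist l (d j)) / 2 by rewrite divr_gt0 // subr_gt0.
  have [m /(_ _ (leqnn m)) rm] := r_small dl.
  apply/yc; exists (i m), m; split=> //.
  rewrite (le_lt_trans (y := mdist l (d j) + r m + r m)) //.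
    rewrite lerD2r (le_trans (metric_triangle _ l _)) // (metric_sym (d j)) lerD2l.
    exact: lle.
  by rewrite -addrA -ltrBrDl (lt_le_trans (ltrD rm rm)) // -splitr.
apply: le_lt_trans lt; rewrite (le_trans (metric_triangle _ (d j') _)) //.
by rewrite addrC (metric_sym (d j')) lerD2l lle.
Qed.

Let code_inj : injective code.
Proof.
move=> x x' cE; apply/eqP; rewrite -[_ == _]negbK -mdist_gt0; apply/negP => xx.
have xx2 : 0 < mdist x x' / 2 by rewrite divr_gt0.
have [n /(_ _ (leqnn n)) rn] := r_small xx2.
have [i xi] := dP x (r_gt0 n).
have x'i : mdist x' (d i) < r n by rewrite -codeE -cE codeE.
suff : mdist x x' < mdist x x' by rewrite ltxx.
rewrite (le_lt_trans (metric_triangle _ (d i) _)) // [ltRHS]splitr (metric_sym (d i)).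
by rewrite ltrD // (lt_trans _ rn).
Qed.

Let code_open (U : set P) : open U -> exists2 S, bor S & U = [set x | S (code x)].
Proof.
move=> oU; exists [set y | exists i n, (forall x, mdist x (d i) < r n -> U x) /\
    y (pair_nat i n) != 0%N].
  apply: (sigma_ex bor_sigma) => i; apply: (sigma_ex bor_sigma) => n.
  apply: (sigma_and bor_sigma); first exact: (sigma_const bor_sigma).
  exact: (bnat_pred bor_sigma (fun n => n != 0%N) (bfun_id _)).
apply/seteqP; split=> [x Ux|x [i [n [h]]]] /=; last by rewrite codeE => /h.
move: oU; rewrite openE => /(_ _ Ux) /nbhs_ballP[eps /= e0 eU].
have e20 : 0 < eps / 2 by rewrite divr_gt0.
have [n /(_ _ (leqnn n)) rn] := r_small e20.
have [i xi] := dP x (r_gt0 n); exists i, n; rewrite codeE; split=> // z zi.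
apply: eU; rewrite ballEmdist /= (le_lt_trans (metric_triangle _ (d i) _)) //.
by rewrite [ltRHS]splitr (metric_sym (d i)) ltrD // (lt_trans _ rn).
Qed.

Lemma dense_coding : exists (c : P -> baire) (B : set baire),
  [/\ bfun <<s open >> c, injective c, bor B, forall y, B y <-> exists x, c x = y
    & forall U, open U -> exists2 S, bor S & U = [set x | S (c x)]].
Proof.
exists code, [set y | is_code y]; split=> //.
  move=> k; have sP := @generated_sigma_algebra P open.
  have : bnat <<s open >> (fun x : P => nat_of_bool
      `[< mdist x (d (unpair k).1) < r (unpair k).2 >]).
    by apply: (bnat_bool sP); apply: sub_gen_smallest; exact: open_mdist_ball.
  by move=> h j; apply: (sigma_iff _ (h j)) => x; rewrite asboolb.
by move=> y; split=> [/code_surj//|[x <-]]; exact: code_is_code.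
Qed.

End dense_code.

Lemma polish_coding : polish P -> exists (c : P -> baire) (B : set baire),
  [/\ bfun <<s open >> c, injective c, bor B, forall y, B y <-> exists x, c x = y
    & forall U, open U -> exists2 S, bor S & U = [set x | S (c x)]].
Proof.
move=> [[S cS dS] complete].
(* A dense sequence needs a point; the empty space is coded by the empty set. *)
have [[x0 _]|noP] := pselect (exists x : P, True).
  by have [d dP] := countable_dense_seq x0 cS dS; exact: (@dense_coding d).
have abs (x : P) : False by apply: noP; exists x.
exists (fun _ _ => 0%N), set0; split=> //.
- by move=> i j; exact: (sigma_const (generated_sigma_algebra _)).
- exact: (sigma_const bor_sigma False).
- by move=> y; split=> // -[x]; case: (abs x).
- move=> U _; exists set0; first exact: (sigma_const bor_sigma False).
  by apply/seteqP; split=> x; case: (abs x).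
Qed.
End polish_code.

Section least.
Context {T : Type} (P : nat -> T -> Prop).

(* The junk value [0] is taken when no [P n x] holds. *)
Definition least (x : T) : nat := xget 0 [set n | P n x /\ forall i, i < n -> ~ P i x].

Lemma leastP x : (exists n, P n x) -> P (least x) x /\ forall i, i < least x -> ~ P i x.
Proof.
move=> [n Pn]; rewrite /least; case: xgetP => [m _ //|h]; exfalso.
have ex : exists n, `[< P n x >] by exists n; apply/asboolP.
case: (ex_minnP ex) => m /asboolP Pm hm; apply: (h m); split=> // i im /asboolP/hm.
by rewrite leqNgt im.
Qed.

Lemma bnat_least (M : set_system T) : sigma_algebra setT M ->
  (forall n, M [set x | P n x]) -> bnat M least.
Proof.
move=> sM MP j; apply: (@sigma_iff _ M (fun x =>
    (P j x /\ forall i, i < j -> ~ P i x) \/ (j = 0 /\ ~ exists n, P n x))).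
  move=> x; split=> [[[Pj hj]|[-> nP]]|<-].
  - have [Pl hl] := leastP (ex_intro _ j Pj).
    by case: (ltngtP (least x) j) => // [/hj|/hl].
  - by rewrite /least; case: xgetP => // n _ [Pn _]; case: nP; exists n.
  - by have [/leastP|] := pselect (exists n, P n x); [left|right; split=> //;
      rewrite /least; case: xgetP => // n _ [Pn _]; case: b; exists n].
apply: (sigma_or sM).
  apply: (sigma_and sM) => //; apply: (sigma_all sM) => i; apply: (sigma_imp sM).
    exact: (sigma_const sM).
  exact: (sigma_not sM).
apply: (sigma_and sM); first exact: (sigma_const sM).
by apply: (sigma_not sM); apply: (sigma_ex sM).
Qed.

End least.

Lemma borel_sigma (R : realType) (X : stdBorelType R) : sigma_algebra setT (@borel R X).
Proof.
case: X => X M [P [f [_ _ /= ->]]]; have sP := @generated_sigma_algebra P open; split.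
- by exists set0; [case: sP|rewrite preimage_set0].
- move=> _ [B bB <-]; exists (~` B); first by rewrite -setTD; case: sP => _ + _; exact.
  by rewrite setTD preimage_setC.
- move=> A hA; have /choice[B hB] : forall n, exists B, <<s open >> B /\ f @^-1` B = A n.
    by move=> n; have [B bB fB] := hA n; exists B.
  exists (\bigcup_n B n); first by case: sP => _ _; apply=> n; case: (hB n).
  by rewrite preimage_bigcup; apply: eq_bigcupr => n _; case: (hB n).
Qed.

Definition coding (X : Type) (M : set_system X) (c : X -> baire) (B : set baire) :=
  [/\ bfun M c, injective c, bor B, forall y, B y <-> exists x, c x = y
    & forall A, M A -> exists2 S, bor S & A = [set x | S (c x)]].

Lemma std_coding (R : realType) (X : stdBorelType R) : exists c B, coding (@borel R X) c B.
Proof.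
have sX := borel_sigma X.
case: X sX => X M [P [f [polP [g fK gK] /= ME]]] /= sX.
have [c [B [mc injc bB rB oB]]] := polish_coding polP.
exists (c \o f), B; split=> //.
- by move=> i j; rewrite ME; exists [set x | c x i = j]; first exact: mc.
- exact: inj_comp injc (can_inj fK).
- by move=> y; rewrite rB; split=> -[x <-]; [exists (g x); rewrite /= gK|exists (f x)].
- move=> A; rewrite ME => -[U bU <-].
  suff [S bS ->] : exists2 S, bor S & U = [set x | S (c x)] by exists S.
  move: U bU; apply: smallest_sub oB; split=> /=.
  + by exists set0; first exact: (sigma_const bor_sigma False).
  + move=> U [S bS ->]; exists [set y | ~ S y]; first exact: (sigma_not bor_sigma).
    by apply/seteqP; split=> x => [[]//|].
  + move=> U hU; have /choice[S hS] : forall n, exists S, bor S /\ U n = [set x | S (c x)].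
      by move=> n; have [S ? ?] := hU n; exists S.
    exists [set y | exists n, S n y].
      by apply: (sigma_ex bor_sigma) => n; case: (hS n).
    apply/seteqP; split=> x => [[n _]|[n Sn]].
      by case: (hS n) => _ -> Sn; exists n.
    by exists n => //; case: (hS n) => _ ->.
Qed.

(** * Lusin's theorems transferred to standard Borel spaces *)

Section std.
Variables (R : realType) (X : stdBorelType R).
Notation M := (@borel R X).
Let sM : sigma_algebra setT M := borel_sigma X.

(** Each set of points with [g x i = j] is the trace of a Borel set [S (i, j)]; the extension takes
    the least [j] whose [S (i, j)] contains the given point, which on the range of [c] is the only
    one. *)
Lemma coding_extend (c : X -> baire) B (g : X -> baire) : coding M c B -> bfun M g ->
  exists2 G : baire -> baire, bfun bor G & forall x, g x = G (c x).
Proof.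
move=> [mc injc bB rB MS] mg.
have /choice[S hS] : forall ij : nat * nat, exists S, bor S /\
    [set x | g x ij.1 = ij.2] = [set x | S (c x)].
  by move=> [i j]; have [S ? ?] := MS _ (mg i j); exists S.
exists (fun y i => least (fun j y => S (i, j) y) y).
  by move=> i; apply: (bnat_least bor_sigma) => j; case: (hS (i, j)).
move=> x; apply/funext => i.
have SE j : S (i, j) (c x) <-> g x i = j.
  have [_ /(congr1 (fun A : set X => A x))/= E] := hS (i, j).
  by rewrite -[S _ _]E.
have [|+ _] := @leastP _ (fun j y => S (i, j) y) (c x); first by exists (g x i); apply/SE.
by move/SE.
Qed.

Lemma std_analytic_image (g : X -> baire) A : bfun M g -> M A -> analytic (g @` A).
Proof.
have [c [B cB]] := std_coding X => mg MA; have [G mG gG] := coding_extend cB mg.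
case: cB => mc injc bB rB /(_ _ MA)[S bS AS].
have -> : g @` A = G @` [set y | S y /\ B y].
  apply/seteqP; split=> [_ [x Ax <-]|_ [y [Sy /rB[x xy]] <-]].
    by exists (c x) => //; split; [move: Ax; rewrite AS|apply/rB; exists x].
  by exists x; [rewrite AS /= xy|rewrite gG xy].
by apply: analytic_image => //; exact: (sigma_and bor_sigma).
Qed.

Lemma std_bor_image (g : X -> baire) A : bfun M g -> M A ->
  (forall x y, A x -> A y -> g x = g y -> x = y) -> bor (g @` A).
Proof.
have [c [B cB]] := std_coding X => mg MA injg; have [G mG gG] := coding_extend cB mg.
case: cB => mc injc bB rB /(_ _ MA)[S bS AS].
have -> : g @` A = G @` [set y | S y /\ B y].
  apply/seteqP; split=> [_ [x Ax <-]|_ [y [Sy /rB[x xy]] <-]].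
    by exists (c x) => //; split; [move: Ax; rewrite AS|apply/rB; exists x].
  by exists x; [rewrite AS /= xy|rewrite gG xy].
apply: image_bor => //; first exact: (sigma_and bor_sigma).
move=> a b [Sa /rB[x xa]] [Sb /rB[y yb]]; rewrite -xa -yb -!gG => gxy; congr c.
by apply: injg => //; rewrite AS /= ?xa ?yb.
Qed.

(** The saturation of a partial transversal is the preimage of an injective Borel image. This is the
    source of the Borelness of all ranks and class sizes below. *)
Lemma std_saturation (g : X -> baire) A : bfun M g -> M A ->
  (forall x y, A x -> A y -> g x = g y -> x = y) ->
  M [set x | exists2 y, A y & g x = g y].
Proof.
move=> mg MA injg; have := bfun_pre sM mg (std_bor_image mg MA injg).
by apply: sigma_iff => x; split=> -[y Ay E]; exists y.
Qed.

(** The normal form is taken with the sets [G y i = j] as the [S k]: equality of [g] becomes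
    equality of their indicators, which are read at the coordinates [e]. *)
Lemma std_dichotomy (g : X -> baire) : bfun M g ->
  (exists B : nat -> set X, [/\ forall n, M (B n), forall x, exists n, B n x
     & forall n x y, B n x -> B n y -> g x = g y -> x = y]) \/
  (exists h : baire -> X, [/\ forall A, M A -> bor [set b | A (h b)],
     forall b b', g (h b) = g (h b')
   & forall b b', h b = h b' -> forall n, (b n != 0) = (b' n != 0)]).
Proof.
move=> mg; have [c [B cB]] := std_coding X; have [G mG gG] := coding_extend cB mg.
case: cB => mc injc bB rB MS.
have [|psi [mpsi psi0 cpsi psiS]] :=
    normal_form (S := fun k => [set y | G y (unpair k).1 = (unpair k).2]) bB.
  by move=> k; exact: mG.
pose e k := pair_nat k.+2 0.
have psi_inj y y' : psi y = psi y' -> y = y' by move=> E; rewrite -(psi0 y) E psi0.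
have eE y y' : psi y \o e = psi y' \o e <-> G y = G y'.
  split=> [E|E]; last by apply/funext => k; rewrite /= !psiS /= E.
  apply/funext => i; move/(congr1 (fun a => a (pair_nat i (G y' i)))): E.
  rewrite /= !psiS pair_natK /=; case: asboolP => // _.
  by rewrite asboolT.
have [[BB [sBB covBB]]|[h [mh Dh eh injh]]] := lusin_novikov_dichotomy e cpsi.
  left; exists (fun n => [set x | BB n (psi (c x))]); split.
  - move=> n; have [bBn _] := sBB n.
    exact: (bfun_pre sM mc (bfun_pre bor_sigma mpsi bBn)).
  - by move=> x; apply: covBB; exists (c x) => //; apply/rB; exists x.
  - move=> n x y Bx By gxy; apply: injc; apply: psi_inj; apply: (sBB n).2.
    + by split=> //; exists (c x) => //; apply/rB; exists x.
    + by split=> //; exists (c y) => //; apply/rB; exists y.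
    + by apply/eE; rewrite -!gG.
right; have /choice[hX hXE] : forall b, exists x, psi (c x) = h b.
  by move=> b; have [y /rB[x <-] <-] := Dh b; exists x.
have cE b : c (hX b) = brow (h b) 0 by rewrite -hXE psi0.
exists hX; split.
- move=> A /MS[S bS ->] /=.
  apply: (@sigma_iff _ bor (fun b => S (brow (h b) 0))); first by move=> b; rewrite cE.
  by apply: (bfun_pre bor_sigma (f := fun b => brow (h b) 0)) => // l; exact: mh.
- by move=> b b'; rewrite !gG; apply/eE; rewrite !hXE.
- by move=> b b' hh; apply: injh; rewrite -!hXE hh.
Qed.

End std.

(** Cantor's diagonal: bit [n] of [b0] is nonzero exactly when no [b] with [h b] numbered [n] has a
    nonzero bit [n], and the number of [h b0] gives a contradiction. *)
Lemma cantor_uncountable T (h : baire -> T) (C : set T) : countable C ->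
  (forall b, C (h b)) ->
  ~ (forall b b', h b = h b' -> forall n, (b n != 0) = (b' n != 0)).
Proof.
move=> /countable_injP[f injf] Ch inj.
pose P n := exists b, f (h b) = n /\ b n != 0.
pose b0 : baire := fun n => nat_of_bool `[< ~ P n >].
pose n := f (h b0).
have b0P : b0 n != 0 <-> ~ P n by rewrite /b0; case: asboolP.
have nP : ~ P n.
  move=> Pn; have [b [fb bn]] := Pn.
  have /inj/(_ n) : h b = h b0 by apply: injf; rewrite ?inE.
  by rewrite bn => /esym/b0P.
by apply: (nP); exists b0; split=> //; apply/b0P.
Qed.

Lemma lusin_novikov (R : realType) (X : stdBorelType R) (g : X -> baire) :
  bfun (@borel R X) g -> (forall x, countable [set y | g x = g y]) ->
  exists B : nat -> set X, [/\ forall n, borel (B n), forall x, exists n, B n x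
     & forall n x y, B n x -> B n y -> g x = g y -> x = y].
Proof.
move=> mg cg; have [//|[h [_ gh injh]]] := std_dichotomy mg.
by have [] := cantor_uncountable (cg (h (fun=> 0))) (h := h) (fun b => gh _ b) injh.
Qed.

(** The images under [c'] of a Borel set and of its complement are disjoint and analytic. A Borel
    set separating them pulls back along [c] to the required preimage, as the two codes have the
    same range. *)
Lemma borel_iso_of_codes (R : realType) (X Y : stdBorelType R)
    (c : X -> baire) (c' : Y -> baire) :
  bfun (@borel R X) c -> bfun (@borel R Y) c' -> injective c -> injective c' ->
  (forall w, (exists x, c x = w) <-> (exists y, c' y = w)) ->
  exists f : X -> Y, [/\ bijective f, borel_fun (@borel R X) (@borel R Y) f
    & forall x, c' (f x) = c x].
Proof.
move=> mc mc' injc injc' rng.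
have /choice[f fP] : forall x, exists y, c' y = c x by move=> x; apply/rng; exists x.
have /choice[g gP] : forall y, exists x, c x = c' y by move=> y; apply/rng; exists y.
exists f; split=> //.
  exists g => [x|y]; [apply: injc|apply: injc'].
    by rewrite gP fP.
  by rewrite fP gP.
move=> A bA; have bnA := sigma_not (borel_sigma Y) bA.
have [|S [bS AS SA]] :=
    lusin_separation (std_analytic_image mc' bA) (std_analytic_image mc' bnA).
  by move=> _ [y Ay <-] [y' nAy' /injc' E]; apply: nAy'; rewrite E.
apply: (sigma_iff _ (bfun_pre (borel_sigma X) mc bS)) => x; split=> [/SA nA|Afx].
  by apply: contrapT => nAfx; apply: nA; exists (f x).
by apply: AS; exists (f x).
Qed.

Definition cantor : set baire := [set b | forall n, b n <= 1].

Lemma bor_cantor : bor cantor.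
Proof.
apply: (sigma_all bor_sigma) => n.
exact: (bnat_pred bor_sigma (fun k => k <= 1) (bfun_id n)).
Qed.

(* Schroeder-Bernstein: by Lusin-Souslin all the images it uses are Borel. *)
Lemma borel_iso_cantor (R : realType) (X : stdBorelType R) : ~ countable [set: X] ->
  exists v : X -> baire, [/\ bfun (@borel R X) v, injective v
    & forall b, (exists x, v x = b) <-> cantor b].
Proof.
move=> ncX; have sM := borel_sigma X.
have [c [B [mc injc bB rB MS]]] := std_coding X.
(* For a constant map the whole space is one fibre, so a partial transversal has at most one point:
   [X] is countable or contains a Borel copy of the Cantor set. *)
have [|[BB [_ covB injB]]|[h [mh _ injh]]] := @std_dichotomy _ X (fun _ _ => 0).
- by move=> i j; exact: (sigma_const sM).
- exfalso; apply: ncX; apply/countable_injP; exists (least BB) => x y _ _ E.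
  have [Bx _] := leastP (covB x); have [By _] := leastP (covB y).
  by apply: (injB (least BB x)) => //; rewrite E.
pose i0 x : baire := fun k => nat_of_bool `[< c x (unpair k).1 = (unpair k).2 >].
have mi0 : bfun (@borel R X) i0 by move=> k; apply: (bnat_bool sM); exact: mc.
have i0_inj : injective i0.
  move=> x y E; apply: injc; apply/funext => i.
  move/(congr1 (fun a => a (pair_nat i (c y i)))): E.
  by rewrite /i0 pair_natK /=; case: asboolP => // _; rewrite asboolT.
have i0K x : cantor (i0 x) by move=> k; rewrite /i0; case: asboolP.
have hK b b' : cantor b -> cantor b' -> h b = h b' -> b = b'.
  move=> kb kb' E; apply/funext => n; move: (injh _ _ E n) (kb n) (kb' n).
  by case: (b n) (b' n) => [|[|?]] [|[|?]].
have mch : bfun bor (c \o h) by move=> i j; exact: (mh _ (mc i j)).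
have borel_h S : bor S -> borel [set x | exists b, [/\ cantor b, S b & h b = x]].
  move=> bS; have bKS : bor [set b | cantor b /\ S b].
    by apply: (sigma_and bor_sigma) => //; exact: bor_cantor.
  have : bor ((c \o h) @` [set b | cantor b /\ S b]).
    by apply: image_bor => // a b [ka _] [kb _] /injc; exact: hK.
  move/(bfun_pre sM mc); apply: sigma_iff => x; split=> [[b [kb Sb] /injc E]|[b [kb Sb E]]].
    by exists b.
  by exists b => //=; rewrite E.
(* The points that [h] misses on the Cantor set, and their iterates under [i0] followed by [h].
   There the bijection is [i0]; elsewhere it inverts [h]. *)
pose fix A n : set X := if n is m.+1 then [set x | exists b, [/\ cantor b, (i0 @` A m) b & h b = x]]
  else [set x | ~ exists b, [/\ cantor b, True & h b = x]].
have bA n : borel (A n).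
  elim: n => [|n ih] /=.
    by apply: (sigma_not sM); apply: borel_h; exact: (sigma_const bor_sigma True).
  by apply: borel_h; apply: std_bor_image => // x y _ _; exact: i0_inj.
pose AA := [set x | exists n, A n x].
have bAA : borel AA by exact: (sigma_ex sM).
have hback x : ~ AA x -> exists b, cantor b /\ h b = x.
  move=> nA; have : ~ A 0 x by move=> A0; apply: nA; exists 0.
  by move=> /contrapT[b [? _ ?]]; exists b.
have /choice[v vP] : forall x, exists b, (AA x -> b = i0 x) /\ (~ AA x -> cantor b /\ h b = x).
  move=> x; have [Ax|nA] := pselect (AA x); first by exists (i0 x).
  by have [b hb] := hback _ nA; exists b.
have cross x y : AA x -> ~ AA y -> v x <> v y.
  move=> Ax nA E; apply: (nA); have [_ /(_ nA)[kv hv]] := vP y.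
  have [/(_ Ax) vx _] := vP x; case: Ax => n An; exists n.+1, (v y); split=> //.
  by exists x => //; rewrite -vx.
exists v; split.
- move=> i j; apply: (@sigma_iff _ (@borel R X) (fun x => (AA x /\ i0 x i = j) \/
    (~ AA x /\ exists b, [/\ cantor b, b i = j & h b = x]))).
    move=> x; have [v1 v2] := vP x; split=> [[[Ax <-]|[nA [b [kb <- hb]]]]|<-].
    + by rewrite v1.
    + have [kv hv] := v2 nA; congr (_ i); apply: hK => //; by rewrite hv.
    + have [Ax|nA] := pselect (AA x); [left|right]; first by rewrite v1.
      by split=> //; exists (v x); have [? ?] := v2 nA.
  apply: (sigma_or sM); apply: (sigma_and sM) => //; first exact: mi0.
    exact: (sigma_not sM).
  exact: (borel_h _ (bor_cyl i j)).
- move=> x y E; have [x1 x2] := vP x; have [y1 y2] := vP y.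
  have [Ax|nAx] := pselect (AA x); have [Ay|nAy] := pselect (AA y).
  + by apply: i0_inj; rewrite -x1 // -y1.
  + by case: (cross x y).
  + by case: (cross y x).
  + by have [_ <-] := x2 nAx; have [_ <-] := y2 nAy; rewrite E.
- move=> b; split=> [[x <-]|kb].
    by have [v1 v2] := vP x; have [/v1->|/v2[]] := pselect (AA x).
  have [[[|n] An]|nA] := pselect (AA (h b)).
  + by case: An; exists b.
  + case: An => b' [kb' [a Aa ab'] /hK -/(_ kb' kb) E]; exists a.
    by have [-> //] := vP a; [rewrite ab'|exists n].
  + by exists (h b); have [_ /(_ nA)[kv hv]] := vP (h b); exact: hK.
Qed.

(** * Cardinalities and ranks *)

Definition ltw (k : nat) (m : natw) : Prop := if m is Fin n then k < n else True.

Lemma ltw_inj m m' : (forall k, ltw k m <-> ltw k m') -> m = m'.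
Proof.
case: m m' => [n|] [n'|] //= h.
- congr Fin; case: (ltngtP n n') => // nn.
    by have [_] := h n; rewrite nn ltnn => /(_ isT).
  by have [+ _] := h n'; rewrite nn ltnn => /(_ isT).
- by have [_ /(_ I)] := h n; rewrite ltnn.
- by have [/(_ I)] := h n'; rewrite ltnn.
Qed.

Lemma has_natw_card T U (A : set T) (B : set U) m : A #= B -> has_natw A m -> has_natw B m.
Proof. by rewrite card_eq_sym => BA; case: m => [n|] /=; apply: card_eq_trans. Qed.

Lemma has_natw_uniq T (A : set T) m m' : has_natw A m -> has_natw A m' -> m = m'.
Proof.
case: m m' => [n|] [n'|] //=; rewrite card_eq_sym => A1 A2; have := card_eq_trans A1 A2.
- by move=> /card_eq_II ->.
- by move=> E; have [] := infinite_nat; apply/finite_setP; exists n; rewrite card_eq_sym.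
- by move=> E; have [] := infinite_nat; apply/finite_setP; exists n'.
Qed.

Lemma num_natw_card T U (A : set T) (B : set U) : A #= B -> num_natw A = num_natw B.
Proof.
move=> AB; congr xget; apply/funext => m; apply/propext; split; apply: has_natw_card => //.
by rewrite card_eq_sym.
Qed.

Lemma has_cardC_card T U (A : set T) (B : set U) c : A #= B -> has_cardC A c -> has_cardC B c.
Proof.
case: c => [m|] AB /=; first exact: has_natw_card.
by rewrite card_eq_sym in AB; exact: card_eq_trans.
Qed.

Lemma num_cardC_card T U (A : set T) (B : set U) : A #= B -> num_cardC A = num_cardC B.
Proof.
move=> AB; congr xget; apply/funext => m; apply/propext; split; apply: has_cardC_card => //.
by rewrite card_eq_sym.
Qed.

Lemma has_natw_countable T (A : set T) m : has_natw A m -> countable A.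
Proof.
case: m => [n|] /=; last by rewrite card_eq_le => /andP[].
by move=> An; apply: finite_set_countable; exists n.
Qed.

Lemma continuum_uncountable T (A : set T) : A #= [set: set nat] -> ~ countable A.
Proof.
move=> AE; rewrite (eq_countable AE) => cs.
apply: (@cantor_uncountable _ (fun b => [set n | b n != 0]) _ cs) => // b b' E n.
by move/(congr1 (fun S : set nat => S n)): E => /= E; apply/idP/idP; rewrite E.
Qed.

Lemma has_cardC_uniq T (A : set T) c c' : has_cardC A c -> has_cardC A c' -> c = c'.
Proof.
case: c c' => [m|] [m'|] //=.
- by move=> Am Am'; rewrite (has_natw_uniq Am Am').
- by move=> /has_natw_countable cA /continuum_uncountable.
- by move=> /continuum_uncountable nA /has_natw_countable.
Qed.

Lemma num_cardC_eq T (A : set T) c : has_cardC A c -> num_cardC A = c.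
Proof. by move=> Ac; apply: has_cardC_uniq (Ac); exact: xgetPex (ex_intro _ c Ac). Qed.

Definition rk (A : set nat) (n : nat) : nat := count (fun i => `[< A i >]) (iota 0 n).

Lemma rkS A n : rk A n.+1 = rk A n + `[< A n >].
Proof. by rewrite /rk -addn1 iotaD count_cat /= addn0. Qed.

Lemma rk_le A m n : m <= n -> rk A m <= rk A n.
Proof.
move=> /subnKC <-; elim: (n - m) => [|k ih]; first by rewrite addn0.
by rewrite addnS rkS (leq_trans ih) // leq_addr.
Qed.

Lemma rk_lt (A : set nat) m n : A m -> m < n -> rk A m < rk A n.
Proof.
by move=> Am mn; apply: leq_trans (rk_le A mn); rewrite rkS asboolT // addn1.
Qed.

Lemma rk_inj (A : set nat) m n : A m -> A n -> rk A m = rk A n -> m = n.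
Proof.
by move=> Am An E; case: (ltngtP m n) => // /(@rk_lt A); rewrite E ltnn; [move=> /(_ Am)|move=> /(_ An)].
Qed.

Lemma rk_down A n k : k < rk A n -> exists a, [/\ a < n, A a & rk A a = k].
Proof.
elim: n => // n ih; rewrite rkS; have [An|nA] := pselect (A n); last first.
  rewrite asboolF // addn0 => /ih[a [an Aa rka]]; exists a; split=> //.
  exact: ltnW.
rewrite asboolT // addn1 ltnS leq_eqVlt => /orP[/eqP ->|/ih[a [an Aa rka]]].
  by exists n.
by exists a; split=> //; exact: ltnW.
Qed.

(** The ranks of the members of [A] form an initial segment of the integers equinumerous to [A], and
    [m] alone determines it. *)
Lemma rk_range (A : set nat) m k : has_natw A m -> (exists2 a, A a & rk A a = k) <-> ltw k m.
Proof.
move=> Am; pose I := rk A @` A.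
have Im : has_natw I m.
  apply: has_natw_card Am; rewrite card_eq_sym; apply: inj_card_eq => a b.
  by rewrite !inE; exact: rk_inj.
suff E : I = [set k | ltw k m] by rewrite -[X in X <-> _]/(I k) E.
have Idown k' k'' : I k'' -> k' < k'' -> I k'.
  move=> [a Aa <-] /rk_down[a' [_ Aa' <-]]; by exists a'.
have [exk|/forallNP allk] := pselect (exists k, ~ I k).
  have [] := @leastP _ (fun k (_ : unit) => ~ I k) tt exk; set k0 := least _ _ => nI lI.
  have IE : I = `I_k0.
    apply/seteqP; split=> k' /= Ik'; last by apply: contrapT; exact: lI.
    rewrite ltnNge; apply/negP; rewrite leq_eqVlt => /orP[/eqP E|]; first by rewrite E in nI.
    by move=> /(Idown _ _ Ik').
  have -> : m = Fin k0 by apply: has_natw_uniq Im _; rewrite IE /=.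
  by rewrite IE.
have IE : I = setT by apply/seteqP; split=> // k' _; exact: contrapT (allk k').
have -> : m = Omega by apply: has_natw_uniq Im _; rewrite IE /=.
by rewrite IE; apply/seteqP.
Qed.

(** Expresses cardinality by quantifiers over integers only, so that it is a Borel condition when
    membership is. *)
Lemma has_natw_rk (A : set nat) m :
  has_natw A m <-> forall k, (exists a, A a /\ rk A a = k) <-> ltw k m.
Proof.
have ex2 k : (exists a, A a /\ rk A a = k) <-> (exists2 a, A a & rk A a = k).
  by split=> [[a []]|[a]]; exists a.
split=> [Am k|h]; first by rewrite ex2; exact: rk_range.
have [m' Am'] := countable_has_natw (countableP A).
suff -> : m = m' by [].
by apply: ltw_inj => k; rewrite -h ex2; exact: rk_range.
Qed.

Section rank_borel.
Context {T : Type} {M : set_system T} (sM : sigma_algebra setT M).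
Variable P : T -> set nat.
Hypothesis MP : forall n, M [set x | P x n].

Lemma bnat_rk N : bnat M (fun x => rk (P x) N).
Proof.
elim: N => [|N ih]; first by move=> j; exact: (sigma_const sM (0 = j)).
move=> j; apply: (sigma_iff _ (bnat_comp2 sM addn ih (bnat_bool sM (MP N)) j)) => x.
by rewrite rkS.
Qed.

Lemma sigma_has_natw m : M [set x | has_natw (P x) m].
Proof.
apply: (sigma_iff (fun x => iff_sym (has_natw_rk (P x) m))).
apply: (sigma_all sM) => k; apply: (sigma_equiv sM); last exact: (sigma_const sM).
by apply: (sigma_ex sM) => a; apply: (sigma_and sM) => //; exact: bnat_rk.
Qed.

End rank_borel.

Definition natw_code (m : natw) : nat := if m is Fin n then n.+1 else 0.
Definition natw_decode (n : nat) : natw := if n is k.+1 then Fin k else Omega.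

Lemma natw_codeK : cancel natw_code natw_decode. Proof. by case. Qed.

Lemma sigma_natw T (M : set_system T) (sM : sigma_algebra setT M) (f : T -> natw)
    (P : natw -> T -> Prop) : (forall m, M [set x | f x = m]) ->
  (forall m, M [set x | P m x]) -> M [set x | P (f x) x].
Proof.
move=> Mf MP; apply: (@sigma_iff _ M (fun x => exists n, f x = natw_decode n /\ P (natw_decode n) x)).
  move=> x /=; split=> [[n [<- //]]|Px].
  by exists (natw_code (f x)); rewrite natw_codeK.
by apply: (sigma_ex sM) => n; exact: (sigma_and sM).
Qed.

(** * The codes of a pair of equivalence relations *)

Lemma smooth_code (R : realType) (X : stdBorelType R) (E : X -> X -> Prop) : smooth E ->
  exists2 g : X -> baire, bfun (@borel R X) g & forall x y, E x y <-> g x = g y.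
Proof.
move=> [Z [f [mf fE]]]; have [c [B [mc injc _ _ _]]] := std_coding Z.
exists (c \o f) => [i j|x y]; first exact: (mf _ (mc i j)).
by rewrite fE; split=> [fxy|/injc]; rewrite /= ?fxy.
Qed.

Section pair_code.
Variables (R : realType) (X : stdBorelType R) (E F : X -> X -> Prop).
Notation M := (@borel R X).
Let sM : sigma_algebra setT M := borel_sigma X.
Hypothesis eE : RelationClasses.Equivalence E.
Hypothesis eF : RelationClasses.Equivalence F.
Hypothesis cF : forall x, countable (F x).
Hypothesis EF : forall x y, E x y -> F x y.
Variables gE gF : X -> baire.
Hypothesis mgE : bfun M gE.
Hypothesis mgF : bfun M gF.
Hypothesis gEP : forall x y, E x y <-> gE x = gE y.
Hypothesis gFP : forall x y, F x y <-> gF x = gF y.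
Variable idx : X -> nat.
Hypothesis midx : bnat M idx.
Hypothesis idx_inj : forall x y, F x y -> idx x = idx y -> x = y.

Let Er x : E x x. Proof. by case: eE. Qed.
Let Es x y : E x y -> E y x. Proof. by case: eE => _ + _; exact. Qed.
Let Et y x z : E x y -> E y z -> E x z. Proof. by case: eE => _ _; exact. Qed.
Let Fs x y : F x y -> F y x. Proof. by case: eF => _ + _; exact. Qed.
Let Ft y x z : F x y -> F y z -> F x z. Proof. by case: eF => _ _; exact. Qed.

(** As [idx] is injective on each [F]-class, parts of a class are handled as sets of integers. Those
    points of [S] that have a given index form a partial transversal, whence [indices_borel]. *)
Definition indices (Q : X -> X -> Prop) (S : set X) (x : X) : set nat :=
  [set n | exists2 y, S y /\ idx y = n & Q x y].

Lemma indices_borel Q g S n : bfun M g -> (forall x y, Q x y <-> g x = g y) ->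
  (forall x y, Q x y -> F x y) -> M S -> M [set x | indices Q S x n].
Proof.
move=> mg gQ QF MS; have MSn : M [set y | S y /\ idx y = n] by exact: (sigma_and sM).
have := std_saturation mg MSn; have inj x y : S x /\ idx x = n -> S y /\ idx y = n ->
    g x = g y -> x = y.
  by move=> [_ xn] [_ yn] /gQ/QF Fxy; apply: idx_inj => //; rewrite xn yn.
by move=> /(_ inj); apply: sigma_iff => x; split=> -[y Sy /gQ]; exists y.
Qed.

Lemma indices_card Q S x : (forall x y, Q x y -> F x y) ->
  [set y | Q x y /\ S y] #= indices Q S x.
Proof.
move=> QF; have -> : indices Q S x = idx @` [set y | Q x y /\ S y].
  by apply/seteqP; split=> [n [y [Sy yn] Qxy]|n [y [Qxy Sy] yn]]; exists y.
rewrite card_eq_sym; apply: inj_card_eq => y y'; rewrite !inE => -[Qy _] [Qy' _].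
by apply: idx_inj; apply: Ft (Fs (QF _ _ Qy)) (QF _ _ Qy').
Qed.

Definition esize (x : X) : natw := num_natw (E x).
(** Leaders represent the [E]-classes, so that counting and ranking classes reduces to counting and
    ranking integers. *)
Definition leader (x : X) : Prop := forall n, indices E setT x n -> idx x <= n.
Definition leaders (m : natw) : set X := [set y | leader y /\ esize y = m].
Definition nlead (m : natw) (x : X) : natw := num_natw (indices F (leaders m) x).
Definition lead_idx : X -> nat := least (fun n x => indices E setT x n).
Definition class_rank (x : X) : nat := rk (indices F (leaders (esize x)) x) (lead_idx x).
Definition elt_rank (x : X) : nat := rk (indices E setT x) (idx x).

Lemma esizeP x : has_natw (indices E setT x) (esize x).
Proof.
apply: (has_natw_card (indices_card setT x EF)).
have -> : [set y | E x y /\ setT y] = E x by apply/seteqP; split=> y // [].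
by apply: num_natwP; apply: sub_countable (cF x); apply: subset_card_le => y /EF.
Qed.

Lemma nleadP m x : has_natw (indices F (leaders m) x) (nlead m x).
Proof. by apply: num_natwP; exact: countableP. Qed.

Lemma sigma_indicesE n : M [set x | indices E setT x n].
Proof. by apply: indices_borel mgE gEP EF _; exact: (sigma_const sM True). Qed.

Lemma sigma_esize m : M [set x | esize x = m].
Proof.
apply: (sigma_iff _ (sigma_has_natw sM sigma_indicesE m)) => x; split=> [h|<-].
  exact: has_natw_uniq (esizeP x) h.
exact: esizeP.
Qed.

Lemma sigma_leaders m : M (leaders m).
Proof.
apply: (sigma_and sM); last exact: sigma_esize.
apply: (sigma_all sM) => n; apply: (sigma_imp sM); first exact: sigma_indicesE.
exact: (bnat_pred sM (fun k => k <= n) midx).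
Qed.

Lemma sigma_indicesF m n : M [set x | indices F (leaders m) x n].
Proof. by apply: indices_borel mgF gFP _ _ => //; exact: sigma_leaders. Qed.

Lemma sigma_nlead m k : M [set x | nlead m x = k].
Proof.
apply: (sigma_iff _ (sigma_has_natw sM (sigma_indicesF m) k)) => x; split=> [h|<-].
  exact: has_natw_uniq (nleadP m x) h.
exact: nleadP.
Qed.

Lemma bnat_lead_idx : bnat M lead_idx.
Proof. exact: (bnat_least sM sigma_indicesE). Qed.

Lemma bnat_class_rank : bnat M class_rank.
Proof.
move=> j; apply: (sigma_natw sM (f := esize)
  (P := fun m x => rk (indices F (leaders m) x) (lead_idx x) = j)).
  exact: sigma_esize.
move=> m; apply: (bnat_pred2 sM (P := fun n x => rk (indices F (leaders m) x) n = j)).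
  exact: bnat_lead_idx.
by move=> n; apply: bnat_rk => //; exact: sigma_indicesF.
Qed.

Lemma bnat_elt_rank : bnat M elt_rank.
Proof.
move=> j; apply: (bnat_pred2 sM (P := fun n x => rk (indices E setT x) n = j)) => // n.
by apply: bnat_rk => //; exact: sigma_indicesE.
Qed.

Lemma E_eq x y : E x y -> E x = E y.
Proof.
by move=> xy; apply/seteqP; split=> z; [exact: Et (Es xy)|exact: Et xy].
Qed.

Lemma F_eq x y : F x y -> F x = F y.
Proof.
by move=> xy; apply/seteqP; split=> z; [exact: Ft (Fs xy)|exact: Ft xy].
Qed.

Lemma indices_eq Q S x y : Q x = Q y -> indices Q S x = indices Q S y.
Proof. by rewrite /indices => ->. Qed.

Lemma nlead_eq m x y : F x y -> nlead m x = nlead m y.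
Proof. by move=> /F_eq xy; rewrite /nlead (indices_eq _ xy). Qed.

Lemma esize_eq x y : E x y -> esize x = esize y.
Proof. by rewrite /esize => /E_eq ->. Qed.

Lemma lead_idxP x : exists y, [/\ E x y, idx y = lead_idx x & leader y].
Proof.
have [|[y [_ yi] xy] h] := @leastP _ (fun n x => indices E setT x n) x.
  by exists (idx x), x.
exists y; split=> // n; rewrite -(indices_eq _ (E_eq xy)) yi => In.
by rewrite leqNgt; apply/negP => /h.
Qed.

Lemma leader_lead_idx x y : E x y -> leader y -> lead_idx x = idx y.
Proof.
move=> xy ly; have [z [xz zi lz]] := lead_idxP x; rewrite -zi; apply/eqP.
have yz := Et (Es xy) xz.
rewrite eqn_leq; apply/andP; split; [apply: lz|apply: ly].
  by exists y => //; exact: Es.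
by exists z.
Qed.

Lemma lead_idx_eq x y : E x y -> lead_idx x = lead_idx y.
Proof.
move=> xy; have [z [yz zi lz]] := lead_idxP y.
by rewrite -zi; apply: leader_lead_idx => //; exact: Et yz.
Qed.

Lemma lead_idx_in x : indices F (leaders (esize x)) x (lead_idx x).
Proof.
have [y [xy yi ly]] := lead_idxP x; exists y; last exact: EF.
by split=> //; split=> //; rewrite (esize_eq xy).
Qed.

(** Points in one [F]-class with classes of the same size are ranked within the same set of leader
    indices, so equal ranks mean the same leader. *)
Lemma E_iff x y : E x y <-> [/\ F x y, esize x = esize y & class_rank x = class_rank y].
Proof.
split=> [xy|[Fxy szE]].
  split; [exact: EF|exact: esize_eq|].
  by rewrite /class_rank (esize_eq xy) (indices_eq _ (F_eq (EF xy))) (lead_idx_eq xy).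
rewrite /class_rank -szE -(indices_eq _ (F_eq Fxy)) => rkE.
have yin : indices F (leaders (esize x)) x (lead_idx y).
  by rewrite szE (indices_eq _ (F_eq Fxy)); exact: lead_idx_in.
have liE := rk_inj (lead_idx_in x) yin rkE.
have [x' [xx' x'i _]] := lead_idxP x; have [y' [yy' y'i _]] := lead_idxP y.
have E' : x' = y'.
  apply: idx_inj; last by rewrite x'i y'i.
  by apply: Ft (Ft (Fs (EF xx')) Fxy) (EF yy').
by apply: Et xx' _; rewrite E'; exact: Es.
Qed.

Lemma eq_iff x y : x = y <-> E x y /\ elt_rank x = elt_rank y.
Proof.
split=> [->//|[xy]]; rewrite /elt_rank -(indices_eq _ (E_eq xy)) => rkE.
apply: idx_inj; first exact: EF.
by apply: rk_inj rkE; [exists x|exists y].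
Qed.

(** The rank [k] selects a leader of size [m] in the class of [x0], and [j] an element of the
    [E]-class of that leader. Only the shape of the [F]-class bounds the two choices. *)
Lemma rank_range x0 m k j :
  (exists x, [/\ F x0 x, esize x = m, class_rank x = k & elt_rank x = j]) <->
  ltw k (nlead m x0) /\ ltw j m.
Proof.
split=> [[x [Fx <- <- <-]]|[kn jm]].
  split.
    rewrite (nlead_eq _ Fx); apply/(rk_range _ (nleadP _ x)).
    by exists (lead_idx x) => //; exact: lead_idx_in.
  by apply/(rk_range _ (esizeP x)); exists (idx x) => //; exists x.
have [_ [y [[ly ym] <-] Fy] rky] := (rk_range k (nleadP m x0)).2 kn.
have := (rk_range j (esizeP y)).2; rewrite ym => /(_ jm)[_ [z [_ <-] yz] rkz].
exists z; split.
- exact: Ft (EF yz).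
- by rewrite -(esize_eq yz).
- rewrite /class_rank -(esize_eq yz) ym (leader_lead_idx (Es yz) ly).
  by rewrite -(indices_eq _ (F_eq (Ft Fy (EF yz)))).
- by rewrite /elt_rank -(indices_eq _ (E_eq yz)).
Qed.

Lemma esize_gt0 x : esize x != Fin 0.
Proof.
apply/eqP => e0; have := esizeP x; rewrite e0 /= II0 card_eq0 => /eqP I0.
by have : indices E setT x (idx x) by [exists x]; rewrite I0.
Qed.

Definition cls (Q : X -> X -> Prop) (x : X) : quot Q := exist _ (Q x) (ex_intro _ x erefl).

(** Each [E]-class contains exactly one leader, so mapping leaders to their classes is a bijection
    onto the classes counted by [lfs]. *)
Lemma lfs_nlead x m : lfs E (cls F x) m = nlead (sval m) x.
Proof.
apply: num_natw_card; apply: card_eq_trans (indices_card _ _ (fun x y (h : F x y) => h)).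
pose A := [set y | F x y /\ leaders (sval m) y]; have -> : [set D : quot E | sval D `<=` sval (cls F x) /\
    has_natw (sval D) (sval m)] = cls E @` A.
  have sz y : has_natw (E y) (esize y).
    apply: has_natw_card (esizeP y); rewrite card_eq_sym.
    have -> : E y = [set z | E y z /\ setT z] by apply/seteqP; split=> z // [].
    exact: indices_card.
  apply/seteqP; split=> [[D [y Dy]] /= [DF Dm]|_ [y [Fy [ly ym]] <-] /=].
    have [z [yz _ lz]] := lead_idxP y.
    exists z; last first.
      by apply: eq_sig_hprop => [? ? ?|] /=; [exact: Prop_irrelevance|rewrite Dy (E_eq yz)].
    rewrite Dy in DF Dm; split; first exact: DF.
    by split=> //; rewrite -(esize_eq yz); exact: has_natw_uniq (sz y) Dm.
  split; last by rewrite -ym.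
  by move=> z yz; exact: Ft (EF yz).
apply: inj_card_eq => y z; rewrite !inE => -[Fy [ly ym]] [Fz [lz zm]].
move=> /(congr1 sval) /= Eyz; have yz : E y z by rewrite Eyz.
apply: idx_inj; first exact: EF.
by rewrite -(leader_lead_idx (Er y) ly); exact: leader_lead_idx.
Qed.

End pair_code.

(** One fixed set of labels for each cardinal, with integers stored as constant sequences. *)
Definition card_range (c : Defs.cardC) : set baire :=
  match c with
  | Defs.Countable m => [set b | exists2 k, ltw k m & b = fun=> k]
  | Continuum => cantor
  end.

Lemma std_card_code (R : realType) (Y : stdBorelType R) c : has_cardC [set: Y] c ->
  exists v : Y -> baire, [/\ bfun (@borel R Y) v, injective v
    & forall b, (exists y, v y = b) <-> card_range c b].
Proof.
case: c => [m|] /=; last by move=> /continuum_uncountable; exact: borel_iso_cantor.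
move=> hm; have sM := borel_sigma Y.
have [u uinj urange] : exists2 u : Y -> nat, injective u & forall k, (exists y, u y = k) <-> ltw k m.
  have : [set: Y] #= [set k | ltw k m].
    have E : [set k | ltw k Omega] = setT by apply/seteqP.
    by case: m hm => [n|] h; [exact: h|rewrite E].
  move=> /card_set_bijP[u [ufun uinj usurj]]; exists u.
    by move=> x y; apply: uinj; rewrite inE.
  move=> k; split=> [[y <-]|/usurj[y _ <-]]; last by exists y.
  exact: ufun.
exists (fun y _ => u y); split.
(* The fibres of [u] have at most one point, and points are Borel because a coding is injective. *)
- move=> _ j; have [[y0 uy0]|nj] := pselect (exists y, u y = j); last first.
    apply: (@sigma_iff _ (@borel R Y) (fun=> False)) => [y|]; last exact: (sigma_const sM).
    by split=> // uy; apply: nj; exists y.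
  have [c [B [mc injc _ _ _]]] := std_coding Y.
  apply: (@sigma_iff _ (@borel R Y) (fun y => c y = c y0)).
    by move=> y; split=> [/injc ->|]; rewrite -?uy0 // => /uinj ->.
  by apply: (bfun_eq sM) => // i k; exact: (sigma_const sM).
- by move=> x y /(congr1 (fun b => b 0)) /uinj.
- move=> b; split=> [[y <-]|[k /urange[y <-] ->]]; last by exists y.
  by exists (u y) => //; apply/urange; exists y.
Qed.

Lemma existT_inj (I : Type) (T : I -> Type) i (x y : T i) :
  existT T i x = existT T i y -> x = y.
Proof.
move=> p; have := projT2_eq p; rewrite (Prop_irrelevance (projT1_eq p) erefl).
by [].
Qed.

Definition cardC_code (c : Defs.cardC) : nat := if c is Defs.Countable m then (natw_code m).+1 else 0.

Lemma cardC_code_inj : injective cardC_code.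
Proof. by move=> [m|] [m'|] //= [/(can_inj natw_codeK) ->]. Qed.

(** * Labels of classes obtained from a parametrization *)

Section parametrization.
Variables (R : realType) (X : stdBorelType R) (F : X -> X -> Prop).
Notation M := (@borel R X).
Let sM : sigma_algebra setT M := borel_sigma X.
Hypothesis eF : RelationClasses.Equivalence F.

Lemma cls_eq x y : F x y <-> cls F x = cls F y.
Proof.
have [r s t] := eF; split=> [xy|/(congr1 sval) /= ->//].
by apply: eq_sig_hprop => [? ? ?|] /=; [exact: Prop_irrelevance|exact: F_eq].
Qed.

Lemma quot_cls (C : quot F) : exists x, C = cls F x.
Proof.
case: C => C [x Cx]; exists x.
by apply: eq_sig_hprop => [? ? ?|] //=; exact: Prop_irrelevance.
Qed.

(** The label [v] is the transported [Y_c]-coordinate. The value of [l] fixes [c] and the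
    [Z_c]-coordinate, so together they determine the class; the classes with one value of [l]
    correspond to all of [Y_c], whose cardinal is [c]. *)
Lemma parametrization_code (V : Type) (l : quot F -> V) :
  borel_parametrizable R (quot_borel M (F := F)) (fun C C' => l C = l C') ->
  exists2 v : X -> baire, bfun M v &
    (forall x y, F x y <-> l (cls F x) = l (cls F y) /\ v x = v y) /\
    (forall a w, (exists x, l (cls F x) = a /\ v x = w) <->
                 card_range (num_cardC [set C | l C = a]) w).
Proof.
move=> [Zp [Yp [phi [cardY [psi phiK psiK] mphi par]]]].
have wP c := cid (std_card_code (cardY c)).
pose w c := sval (wP c).
have mw c : bfun (@borel R (Yp c)) (w c) by case: (svalP (wP c)).
have w_inj c : injective (w c) by case: (svalP (wP c)).
have w_range c b : (exists y, w c y = b) <-> card_range (sval c) b.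
  by case: (svalP (wP c)) => _ _; exact.
pose Phi x := phi (cls F x).
pose v x := w (projT1 (Phi x)) (projT2 (Phi x)).2.
have vE x c z u : Phi x = existT _ c (z, u) -> v x = w c u by rewrite /v => ->.
have mPhi A : sum_borel (fun c => prod_borel (@borel R (Zp c)) (@borel R (Yp c))) A ->
    M [set x | A (Phi x)].
  move=> /mphi; rewrite /quot_borel /=; apply: sigma_iff => x; split=> [[C AC Cx]|Ax].
    suff CE : C = cls F x by rewrite /Phi -CE.
    apply: eq_sig_hprop => [? ? ?|]; [exact: Prop_irrelevance|exact: class_eqP].
  by exists (cls F x) => //=; case: eF.
have mslice c (S : set (Yp c)) : borel S ->
    M [set x | exists z u, Phi x = existT _ c (z, u) /\ S u].
  move=> bS; apply: (mPhi [set p | exists z u, p = existT _ c (z, u) /\ S u]) => c'.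
  have [E|ne] := pselect (c' = c).
    subst c'; rewrite (_ : _ @^-1` _ = setT `*` S).
      apply: sub_gen_smallest; exists setT; first exact: (sigma_const (borel_sigma _) True).
      by exists S.
    apply/seteqP; split=> [[z u] [z' [u' [E Su]]]|[z u] [_ Su]]; last by exists z, u.
    by have [_ ->] := existT_inj E.
  rewrite (_ : _ @^-1` _ = set0); first by case: (generated_sigma_algebra
    [set A `*` B | A in @borel R (Zp c') & B in @borel R (Yp c')]).
  by apply/seteqP; split=> // p [z [u [/(congr1 (@projT1 _ _)) /= /ne]]].
have sameF x y : F x y <-> l (cls F x) = l (cls F y) /\ v x = v y.
  split=> [/cls_eq E|[/par]]; first by rewrite /v /Phi E.
  rewrite -/(Phi x) -/(Phi y); case Ex : (Phi x) => [c [z u]]; case Ey : (Phi y) => [c' [z' u']].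
  rewrite (vE _ _ _ _ Ex) (vE _ _ _ _ Ey) /sum_proj1 /= => E.
  have cc := congr1 (@projT1 _ _) E; rewrite /= in cc; subst c'.
  have {E} zz := existT_inj E; subst z'; move=> /w_inj uu; subst u'.
  by apply/cls_eq; apply: (can_inj phiK); rewrite -/(Phi x) -/(Phi y) Ex Ey.
exists v; last split=> // a b.
  (* The union over the cardinals is countable: [cardC_code] assigns each integer to at most one of
     them. *)
  move=> i j; apply: (@sigma_iff _ M (fun x => exists n, exists c : posC,
    cardC_code (sval c) = n /\ exists z u, Phi x = existT _ c (z, u) /\ w c u i = j)).
    move=> x; split=> [[_ [c [_ [z [u [/vE -> <-]]]]]]//|].
    case Ex : (Phi x) => [c [z u]]; rewrite (vE _ _ _ _ Ex) => wj.
    by exists (cardC_code (sval c)), c; split=> //; exists z, u.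
  apply: (sigma_ex sM) => n.
  have [[c cn]|nc] := pselect (exists c : posC, cardC_code (sval c) = n); last first.
    apply: (@sigma_iff _ M (fun=> False)) => [x|]; last exact: (sigma_const sM).
    by split=> // -[c [cn _]]; apply: nc; exists c.
  apply: (sigma_iff _ (mslice c _ (mw c i j))) => x; split=> [h|[c' [c'n h]]].
    by exists c.
  suff -> : c = c' by [].
  apply: val_inj; apply: cardC_code_inj; by rewrite /= cn c'n.
have card_class x0 c z u : Phi x0 = existT _ c (z, u) ->
    num_cardC [set C | l C = l (cls F x0)] = sval c.
  move=> Ex0; apply: num_cardC_eq; apply: has_cardC_card (cardY c).
  rewrite card_eq_sym (_ : [set C | _] = (fun u => psi (existT _ c (z, u))) @` setT).
    apply: inj_card_eq => u1 u2 _ _ /(can_inj psiK) E.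
    by have [] := existT_inj E.
  apply/seteqP; split=> [C /par|_ [u' _ <-]]; last first.
    by apply/par; rewrite psiK -/(Phi x0) Ex0.
  rewrite -/(Phi x0) Ex0; case EC : (phi C) => [c' [z' u']] E.
  have cc := congr1 (@projT1 _ _) E; rewrite /= in cc; subst c'.
  have {E} /= zz := existT_inj E; subst z'; exists u' => //.
  by rewrite -EC phiK.
split=> [[x [<- <-]]|].
  case Ex : (Phi x) => [c [z u]]; rewrite (card_class _ _ _ _ Ex) (vE _ _ _ _ Ex).
  by apply/w_range; exists u.
(* A value taken by no class has cardinal [Fin 0], whose set of labels is empty. *)
have [[x0 <-]|nx] := pselect (exists x, l (cls F x) = a); last first.
  rewrite (_ : [set C | _] = set0); last first.
    apply/seteqP; split=> // C /= lC; apply: nx; have [x CE] := quot_cls C.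
    by exists x; rewrite -lC CE.
  rewrite (@num_cardC_eq _ _ (Defs.Countable (Fin 0))); first by case.
  by rewrite /= II0 card_eq00.
case Ex0 : (Phi x0) => [c [z u]]; rewrite (card_class _ _ _ _ Ex0) => /w_range[u' <-].
have [x CE] := quot_cls (psi (existT _ c (z, u'))); exists x.
have Ex : Phi x = existT _ c (z, u') by rewrite /Phi -CE psiK.
split; last exact: vE Ex.
by apply/par; rewrite -/(Phi x) -/(Phi x0) Ex Ex0.
Qed.

End parametrization.

(** * Shapes determine the pair *)

(** Position [n] holds the number of classes of size [natw_decode n]; the default 0 fills the
    position of [Fin 0], which is not an admissible size. *)
Definition profile (a : posnatw -> natw) : baire := fun n =>
  if insub (natw_decode n) is Some m then natw_code (a m) else 0.

Lemma profile_code a (m : posnatw) : profile a (natw_code (sval m)) = natw_code (a m).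
Proof. by rewrite /profile natw_codeK (valK m). Qed.

Lemma profile_inj : injective profile.
Proof.
move=> a b ab; apply/funext => m; apply: (can_inj natw_codeK).
by move/(congr1 (fun p : baire => p (natw_code (sval m)))): ab; rewrite !profile_code.
Qed.

(** No space occurs here, which is what lets the codes of two pairs be compared through their global
    fine shapes. *)
Definition shape_range (G : Sf -> Defs.cardC) (b w : baire) (m k j : nat) : Prop :=
  exists (a : Sf) (m' : posnatw),
    [/\ b = profile (sval a), card_range (G a) w, m = natw_code (sval m'),
        ltw k (sval a m') & ltw j (sval m')].

Lemma pair_code (R : realType) (X : stdBorelType R) (E F : X -> X -> Prop) :
  countable_borel_equiv E -> smooth E -> countable_borel_equiv F -> smooth F ->
  (forall x y, E x y -> F x y) ->
  borel_parametrizable R (quot_borel (@borel R X) (F := F)) (lfs_rel E (F := F)) ->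
  exists (b w : X -> baire) (m k j : X -> nat),
    [/\ bfun (@borel R X) b, bfun (@borel R X) w, bnat (@borel R X) m,
        bnat (@borel R X) k & bnat (@borel R X) j] /\
    [/\ forall x y, F x y <-> b x = b y /\ w x = w y,
        forall x y, E x y <-> [/\ F x y, m x = m y & k x = k y],
        forall x y, x = y <-> E x y /\ j x = j y
      & forall b' w' m' k' j',
         (exists x, [/\ b x = b', w x = w', m x = m', k x = k' & j x = j']) <->
         shape_range (gfs E F) b' w' m' k' j'].
Proof.
move=> cE sE cF sF EF par; have sM := borel_sigma X.
have [gE mgE gEP] := smooth_code sE; have [gF mgF gFP] := smooth_code sF.
have [eE _ _] := cE; have [eF _ clF] := cF.
have [|B [mB covB injB]] := lusin_novikov mgF.
  move=> x; suff -> : [set y | gF x = gF y] = F x by [].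
  by apply/seteqP; split=> y /gFP.
pose idx := least B.
have midx : bnat (@borel R X) idx by exact: bnat_least.
have idx_inj x y : F x y -> idx x = idx y -> x = y.
  move=> /gFP gxy ixy; have [Bx _] := leastP (covB x); have [By _] := leastP (covB y).
  by apply: (injB (idx x)) => //; rewrite ixy.
have [w mw [Fw w_range]] := parametrization_code eF par.
pose b x := profile (lfs E (cls F x)).
have lE x m := lfs_nlead eE eF clF EF idx_inj x m.
exists b, w, (fun x => natw_code (esize E x)), (class_rank E F idx), (elt_rank E idx).
split; split=> //.
- move=> n; rewrite /b /profile; case: insubP => [m _ _|_]; last first.
    by move=> j; exact: (sigma_const sM).
  move=> j; apply: (@sigma_iff _ (@borel R X) (fun x => natw_code (nlead E F idx (sval m) x) = j)).
    by move=> x; rewrite lE.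
  apply: (sigma_natw sM (f := nlead E F idx (sval m)) (P := fun n _ => natw_code n = j)).
    by move=> k; exact: (sigma_nlead eF clF EF mgE mgF gEP gFP midx idx_inj).
  by move=> k; exact: (sigma_const sM).
- move=> j; apply: (sigma_natw sM (f := esize E) (P := fun n _ => natw_code n = j)).
    by move=> k; exact: (sigma_esize eF clF EF mgE gEP midx idx_inj).
  by move=> k; exact: (sigma_const sM).
- exact: (bnat_class_rank eF clF EF mgE mgF gEP gFP midx idx_inj).
- exact: (bnat_elt_rank EF mgE gEP midx idx_inj).
- move=> x y; rewrite Fw; split=> -[h1 h2]; split=> //; first by rewrite /b h1.
  exact: profile_inj.
- move=> x y; rewrite (E_iff eE eF EF idx_inj); split=> -[h1 h2 h3]; split=> //.
    by rewrite h2.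
  exact: (can_inj natw_codeK).
- by move=> x y; exact: (eq_iff eE EF idx_inj).
- move=> b' w' m' k' j'; split=> [[x [<- <- <- <- <-]]|[a [m [-> wa -> km jm]]]].
    exists (exist (fun a : posnatw -> natw => exists m, a m != Fin 0) (lfs E (cls F x))
      (lfs_Sf cE cF EF (cls F x))).
    exists (exist (fun m => is_true (m != Fin 0)) (esize E x)
      (esize_gt0 eE eF clF EF idx_inj x)).
    have [k1 j1] : ltw (class_rank E F idx x) (nlead E F idx (esize E x) x) /\
        ltw (elt_rank E idx x) (esize E x).
      apply/(rank_range eE eF clF EF idx_inj); exists x; split=> //.
      by case: eF.
    split=> //=; last by rewrite lE.
    by apply/w_range; exists x.
  (* Shape and label are realised by some class first; the size and the two ranks are then realised
     inside it. *)
  have [x0 [lx0 wx0]] := (w_range _ _).2 wa.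
  have [|x [Fx ex kx jx]] := (rank_range eE eF clF EF idx_inj x0 (sval m) k' j').2.
    by rewrite -lE lx0.
  have [lx wx] := (Fw x0 x).1 Fx.
  by exists x; split=> //; [rewrite /b -lx lx0|rewrite -wx|rewrite ex].
Qed.

(** * Invariance of the global fine shape *)

Section transport.
Variables (R : realType) (X Y : stdBorelType R).

Lemma gfs_invariant (E F : X -> X -> Prop) (E' F' : Y -> Y -> Prop) (f : X -> Y) :
  bijective f -> (forall x y, E x y <-> E' (f x) (f y)) ->
  (forall x y, F x y <-> F' (f x) (f y)) -> gfs E F = gfs E' F'.
Proof.
move=> [g fK gK] fE fF.
have img Q Q' x : (forall x y, Q x y <-> Q' (f x) (f y)) -> f @` (Q x) = Q' (f x).
  move=> h; apply/seteqP; split=> [_ [y /h ? <-]//|y Qy].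
  by exists (g y); rewrite ?gK //; apply/h; rewrite gK.
have f_inj := can_inj fK.
have f_img (A B : set X) : f @` A = f @` B -> A = B.
  suff sub (C D : set X) : f @` C = f @` D -> C `<=` D.
    by move=> AB; apply/seteqP; split; exact: sub.
  by move=> CD x Cx; have : (f @` D) (f x) by [rewrite -CD; exists x]; case=> y Dy /f_inj <-.
have quotE (Q : X -> X -> Prop) (C C' : quot Q) : sval C = sval C' -> C = C'.
  by move=> ?; apply: eq_sig_hprop => // ? ? ?; exact: Prop_irrelevance.
have quotE' (Q : Y -> Y -> Prop) (C C' : quot Q) : sval C = sval C' -> C = C'.
  by move=> ?; apply: eq_sig_hprop => // ? ? ?; exact: Prop_irrelevance.
have /choice[tE tEP] : forall D : quot E, exists D' : quot E', sval D' = f @` sval D.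
  by move=> D; have [x ->] := quot_cls D; exists (cls E' (f x)); rewrite /= (img _ E').
have /choice[tF tFP] : forall D : quot F, exists D' : quot F', sval D' = f @` sval D.
  by move=> D; have [x ->] := quot_cls D; exists (cls F' (f x)); rewrite /= (img _ F').
have tE_inj : injective tE.
  move=> D D' /(congr1 sval); rewrite !tEP => /f_img; exact: quotE.
have tF_inj : injective tF.
  move=> D D' /(congr1 sval); rewrite !tFP => /f_img; exact: quotE.
have tE_surj D' : exists D, tE D = D'.
  have [y DE] := quot_cls D'; exists (cls E (g y)); apply: quotE'.
  by rewrite tEP DE /= (img _ E') // gK.
have tF_surj D' : exists D, tF D = D'.
  have [y DE] := quot_cls D'; exists (cls F (g y)); apply: quotE'.
  by rewrite tFP DE /= (img _ F') // gK.
have hn (D : quot E) m : has_natw (sval (tE D)) m <-> has_natw (sval D) m.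
  have fD : f @` sval D #= sval D by apply: inj_card_eq => ? ? _ _; exact: f_inj.
  rewrite tEP; split; apply: has_natw_card => //.
  by rewrite card_eq_sym.
have lfsE (C : quot F) : lfs E' (tF C) = lfs E C.
  apply/funext => m; apply: num_natw_card.
  rewrite (_ : [set D | _] = tE @` [set D | sval D `<=` sval C /\ has_natw (sval D) (sval m)]).
    by apply: inj_card_eq => ? ? _ _; exact: tE_inj.
  apply/seteqP; split=> [D' [DC Dm]|_ [D [DC Dm] <-]].
    have [D DE] := tE_surj D'; exists D => //; rewrite -DE in DC Dm; split; last exact/hn.
    move=> x Dx; have : sval (tF C) (f x) by apply: DC; rewrite tEP; exists x.
    by rewrite tFP => -[x' Cx' /f_inj <-].
  split; last exact/hn.
  by rewrite tEP tFP; exact: image_subset.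
apply/funext => a; apply: num_cardC_card; rewrite card_eq_sym.
rewrite (_ : [set C | _] = tF @` [set C | lfs E C = sval a]).
  by apply: inj_card_eq => ? ? _ _; exact: tF_inj.
apply/seteqP; split=> [C' Ca|_ [C Ca <-] /=]; last by rewrite lfsE.
have [C CE] := tF_surj C'; exists C => //.
by move: Ca; rewrite /= -CE lfsE.
Qed.

End transport.

(** * Assembling the codes into an isomorphism *)

Definition encode (b w : baire) (m k j : nat) : baire := pack (fun i => match i with
  | 0 => b | 1 => w | 2 => fun=> m | 3 => fun=> k | _ => fun=> j end).

Lemma encode_inj b1 w1 m1 k1 j1 b2 w2 m2 k2 j2 :
  encode b1 w1 m1 k1 j1 = encode b2 w2 m2 k2 j2 ->
  [/\ b1 = b2, w1 = w2, m1 = m2, k1 = k2 & j1 = j2].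
Proof.
move=> e; have ee i := congr1 (fun h => brow h i) e.
move: (ee 0) (ee 1) (ee 2) (ee 3) (ee 4); rewrite !packK => -> -> h2 h3 h4.
by split=> //; [move/(congr1 (fun h => h 0)): h2|move/(congr1 (fun h => h 0)): h3|
  move/(congr1 (fun h => h 0)): h4].
Qed.

Lemma bfun_encode T (M : set_system T) (b w : T -> baire) (m k j : T -> nat) :
  bfun M b -> bfun M w -> bnat M m -> bnat M k -> bnat M j ->
  bfun M (fun z => encode (b z) (w z) (m z) (k z) (j z)).
Proof. by move=> ? ? ? ? ?; apply: bfun_pack => -[|[|[|[|i]]]] //; move=> ?. Qed.

Theorem theorem6p6 (R : realType) (X Y : stdBorelType R)
    (E F : X -> X -> Prop) (E' F' : Y -> Y -> Prop)
    (E_cber : countable_borel_equiv E) (E_smooth : smooth E)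
    (F_cber : countable_borel_equiv F) (F_smooth : smooth F)
    (EF : forall x y, E x y -> F x y)
    (E'_cber : countable_borel_equiv E') (E'_smooth : smooth E')
    (F'_cber : countable_borel_equiv F') (F'_smooth : smooth F')
    (EF' : forall x y, E' x y -> F' x y)
    (lfs_par : borel_parametrizable R (quot_borel (@borel R X) (F := F))
                 (lfs_rel E (F := F)))
    (lfs_par' : borel_parametrizable R (quot_borel (@borel R Y) (F := F'))
                  (lfs_rel E' (F := F'))) :
  pair_borel_iso E F E' F' <-> gfs E F = gfs E' F'.
Proof.
split=> [[f [bf _ fE fF]]|gE]; first exact: gfs_invariant bf fE fF.
have [b [w [m [k [j [[mb mw mm mk mj] [FP EP eqP range]]]]]]] :=
  pair_code E_cber E_smooth F_cber F_smooth EF lfs_par.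
have [b' [w' [m' [k' [j' [[mb' mw' mm' mk' mj'] [FP' EP' eqP' range']]]]]]] :=
  pair_code E'_cber E'_smooth F'_cber F'_smooth EF' lfs_par'.
pose c x := encode (b x) (w x) (m x) (k x) (j x).
pose c' y := encode (b' y) (w' y) (m' y) (k' y) (j' y).
have c_inj : injective c.
  by move=> x y /encode_inj[? ? ? ? ?]; apply/eqP; split=> //; apply/EP; split=> //; apply/FP.
have c'_inj : injective c'.
  by move=> x y /encode_inj[? ? ? ? ?]; apply/eqP'; split=> //; apply/EP'; split=> //; apply/FP'.
have [|f [bf mf cf]] := borel_iso_of_codes (bfun_encode mb mw mm mk mj)
    (bfun_encode mb' mw' mm' mk' mj') c_inj c'_inj.
  move=> h; split=> -[x <-].
    have /range : exists x', [/\ b x' = b x, w x' = w x, m x' = m x, k x' = k x & j x' = j x].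
      by exists x.
    by rewrite gE => /range'[y [h1 h2 h3 h4 h5]]; exists y; rewrite /c' h1 h2 h3 h4 h5.
  have /range' : exists x', [/\ b' x' = b' x, w' x' = w' x, m' x' = m' x, k' x' = k' x
      & j' x' = j' x] by exists x.
  by rewrite -gE => /range[y [h1 h2 h3 h4 h5]]; exists y; rewrite /c h1 h2 h3 h4 h5.
have fP x : [/\ b' (f x) = b x, w' (f x) = w x, m' (f x) = m x & k' (f x) = k x].
  by have /encode_inj[] := cf x.
have fF x y : F x y <-> F' (f x) (f y).
  by rewrite FP FP'; have [-> -> _ _] := fP x; have [-> -> _ _] := fP y.
exists f; split=> // x y; rewrite EP EP'.
have [_ _ -> ->] := fP x; have [_ _ -> ->] := fP y.
by split=> -[/fF ? ? ?]; split.
Qed.
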